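(* Let $g$ be a polynomial of degree $d\in\mathbb{N}$ with $g'(x)\neq 0$ for all $x\in[-1,1]$, let $f:[-1,1]\to\mathbb{C}$ be independent of $\omega$, and let $\nu$ be an even positive integer with $\nu\ge d+1$. Consider the linear system $$\mathsf{P}_\nu\widetilde{\mathsf{A}}\mathsf{P}_\nu\boldsymbol{\alpha}_0=\mathsf{P}_\nu\tilde{\mathbf{f}},\qquad (\ast)$$ with $\mathsf{P}_\nu$, $\widetilde{\mathsf{A}}$, $\tilde{\mathbf{f}}$ as defined in the context. For $\omega$ sufficiently large, the system $(\ast)$ has a unique solution $\boldsymbol{\alpha}_0\in\{\mathbf{x}=(x_0,\dots,x_{\nu+1})\in\mathbb{C}^{\nu+2} : x_0=x_{\nu+1}=0\}$. Moreover, whenever such a solution exists, $(\ast)$ can be solved using $\mathcal{O}(\nu\log\nu+d^2\nu)$ operations, by the application of one discrete cosine transform (DCT-I) and the solution of a banded matrix system of bandwidth $2d+3$.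
   Context: Vectors in $\mathbb{C}^{\nu+2}$ and $(\nu+2)\times(\nu+2)$ matrices are indexed by $0,\dots,\nu+1$. $\mathrm{T}_n$ is the Chebyshev polynomial of the first kind of degree $n$, and $c_m=\cos\bigl(m\pi/(\nu+1)\bigr)$, $0\le m\le\nu+1$, are the Clenshaw--Curtis points. The Levin operator is $\mathcal{L}_\omega=\frac{\mathrm{d}}{\mathrm{d}x}+\mathrm{i}\omega g'(x)$, and $\widetilde{\mathcal{L}}_\omega=(1-x^2)\mathcal{L}_\omega=(1-x^2)\frac{\mathrm{d}}{\mathrm{d}x}+\mathrm{i}\omega(1-x^2)g'(x)$. Put $\widetilde{\mathsf{A}}_{mn}=(\widetilde{\mathcal{L}}_\omega\mathrm{T}_n)(c_m)$ and $\tilde f_m=(1-c_m^2)f(c_m)$ for $m,n=0,\dots,\nu+1$. $\mathsf{P}_\nu:\mathbb{C}^{\nu+2}\to\mathbb{C}^{\nu+2}$ is the projection $(x_0,\dots,x_{\nu+1})\mapsto(0,x_1,\dots,x_\nu,0)$. A matrix is said to be banded of bandwidth $2b+1$ if its $(i,j)$ entry vanishes whenever $|i-j|>b$. The DCT-I on $\mathbb{C}^{\nu+2}$ is the map $\mathbf{x}\mapsto\bigl(\tfrac12x_0+\sum_{n=1}^{\nu}\cos\tfrac{mn\pi}{\nu+1}\,x_n+\tfrac12(-1)^m x_{\nu+1}\bigr)_{m=0}^{\nu+1}$, which can be applied in $\mathcal{O}(\nu\log\nu)$ operations. ''Operations'' are arithmetic operations on complex numbers; the input consists of $\omega$, the coefficients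 of $g$ and the values $f(c_m)$. ''Sufficiently large $\omega$'' may depend on $g$ and $\nu$. *)

(* Defs.v *)
From HB Require Import structures.
From mathcomp Require Import all_boot all_order all_algebra.
From mathcomp Require Import all_classical all_reals all_analysis.
From mathcomp Require Import complex.
Set Implicit Arguments.
Unset Strict Implicit.
Unset Printing Implicit Defensive.
Import Order.TTheory GRing.Theory Num.Theory.
Import numFieldNormedType.Exports.
Local Open Scope ring_scope.
Local Open Scope complex_scope.

(* Algebraic computation trees over a field.  A program works on a growing
   list of registers: [Const] and [Arith] append one register at the end, and
   the input occupies the first registers.  Nothing but constants and registers
   can be mentioned, so a program is one algorithm, uniform in its input; its
   constants may depend only on what is fixed before the program is chosen. *)
Inductive arith_op := Add | Sub | Mul | Div.

Inductive prog (F : Type) : Type :=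
| Return (out : seq nat)
| Const (c : F) (k : prog F)
| Arith (o : arith_op) (i j : nat) (k : prog F)
| IfZero (i : nat) (kz knz : prog F).

Definition arith (F : fieldType) (o : arith_op) (x y : F) : option F :=
  match o with
  | Add => Some (x + y)
  | Sub => Some (x - y)
  | Mul => Some (x * y)
  | Div => if y == 0 then None else Some (x / y)
  end.

Definition tick (T : Type) (r : option (T * nat)) : option (T * nat) :=
  omap (fun u => (u.1, u.2.+1)) r.

(* The output together with the number of operations executed, or [None] on a
   division by zero.  Each arithmetic operation and each zero test counts 1. *)
Fixpoint run (F : fieldType) (p : prog F) (mem : seq F) : option (seq F * nat) :=
  match p with
  | Return out => Some ([seq mem`_i | i <- out], 0%N)
  | Const c k => run k (rcons mem c)
  | Arith o i j k =>
      if arith o mem`_i mem`_j is Some z then tick (run k (rcons mem z)) else None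
  | IfZero i kz knz => tick (run (if mem`_i == 0 then kz else knz) mem)
  end.

Definition vec_entries (F : Type) n (x : 'cV[F]_n) : seq F :=
  [seq x i ord0 | i <- enum 'I_n].

Definition mx_entries (F : Type) n (M : 'M[F]_n) : seq F :=
  [seq M i j | i <- enum 'I_n, j <- enum 'I_n].

Definition banded (F : fieldType) n (w : nat) (M : 'M[F]_n) : Prop :=
  exists2 b : nat, w = (2 * b + 1)%N &
    forall i j : 'I_n, (i + b < j)%N || (j + b < i)%N -> M i j = 0.

Fixpoint chebT (F : fieldType) (n : nat) : {poly F} :=
  match n with
  | 0 => 1
  | m.+1 => match m with
            | 0 => 'X
            | k.+1 => 'X * chebT F m *+ 2 - chebT F k
            end
  end.

Section Levin.
Variable R : realType.

Definition cc_point (nu m : nat) : R := cos (m%:R * pi / nu.+1%:R).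

Definition levin_op (g : {poly R[i]}) (omega : R) (h : {poly R[i]}) : {poly R[i]} :=
  h^`() + ('i * omega%:C) *: (g^`() * h).

Definition levin_op_tilde (g : {poly R[i]}) (omega : R) (h : {poly R[i]}) :
  {poly R[i]} := (1 - 'X^2) * levin_op g omega h.

Definition A_tilde (nu : nat) (g : {poly R[i]}) (omega : R) : 'M[R[i]]_nu.+2 :=
  \matrix_(m, n) (levin_op_tilde g omega (chebT R[i] n)).[(cc_point nu m)%:C].

Definition f_values (nu : nat) (f : R -> R[i]) : 'cV[R[i]]_nu.+2 :=
  \col_m f (cc_point nu m).

Definition f_tilde (nu : nat) (f : R -> R[i]) : 'cV[R[i]]_nu.+2 :=
  \col_m ((1 - cc_point nu m ^+ 2)%:C * f (cc_point nu m)).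

Definition Pnu (nu : nat) (x : 'cV[R[i]]_nu.+2) : 'cV[R[i]]_nu.+2 :=
  \col_m (if (0 < m < nu.+1)%N then x m ord0 else 0).

Definition zero_ends (nu : nat) (x : 'cV[R[i]]_nu.+2) : Prop :=
  x ord0 ord0 = 0 /\ x ord_max ord0 = 0.

Definition levin_system (nu : nat) (g : {poly R[i]}) (omega : R) (f : R -> R[i])
    (alpha : 'cV[R[i]]_nu.+2) : Prop :=
  Pnu (A_tilde nu g omega *m Pnu alpha) = Pnu (f_tilde nu f).

Definition dct1 (nu : nat) (x : 'cV[R[i]]_nu.+2) : 'cV[R[i]]_nu.+2 :=
  \col_m (2^-1 * x ord0 ord0
          + \sum_(n < nu.+2 | (0 < n < nu.+1)%N)
              (cos ((m * n)%:R * pi / nu.+1%:R))%:C * x n ord0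
          + 2^-1 * (-1) ^+ m * x ord_max ord0).

Definition computes_dct1 (nu : nat) (p : prog R[i]) : Prop :=
  forall x : 'cV[R[i]]_nu.+2, exists t : nat,
    run p (vec_entries x) = Some (vec_entries (dct1 x), t).

Definition solves_banded (n w : nat) (p : prog R[i]) : Prop :=
  forall (M : 'M[R[i]]_n) (y : 'cV[R[i]]_n), banded w M ->
    (exists x, M *m x = y) ->
    exists x t, run p (mx_entries M ++ vec_entries y) = Some (vec_entries x, t)
                /\ M *m x = y.

Record dct_band_solver := DctBandSolver {
  prepare : prog R[i];     (* values f(c_m) |-> v *)
  transform : prog R[i];   (* v                        |-> DCT-I of v *)
  finish : prog R[i];      (* DCT-I of v               |-> right-hand side y *)
  assemble : prog R[i];    (* omega, coefficients of g |-> banded matrix M *)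
  band_solve : prog R[i]   (* M, y                     |-> solution of M x = y *)
}.

(* The data flow keeps f apart from (omega, g): the two meet only in the banded
   system, so the reduction cannot hide a solver for the original system in its
   pre- or post-processing. *)
Definition solver_run (nu w : nat) (S : dct_band_solver) (g : {poly R[i]})
    (omega : R) (f : R -> R[i]) (alpha : 'cV[R[i]]_nu.+2) (ops : nat) : Prop :=
  exists (v y : 'cV[R[i]]_nu.+2) (M : 'M[R[i]]_nu.+2) (t1 t2 t3 t4 t5 : nat),
    [/\ run (prepare S) (vec_entries (f_values nu f)) = Some (vec_entries v, t1),
        run (transform S) (vec_entries v) = Some (vec_entries (dct1 v), t2),
        run (finish S) (vec_entries (dct1 v)) = Some (vec_entries y, t3),
        run (assemble S) (omega%:C :: polyseq g) = Some (mx_entries M, t4) &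
    [/\ banded w M,
        run (band_solve S) (mx_entries M ++ vec_entries y)
          = Some (vec_entries alpha, t5),
        M *m alpha = y &
        ops = (t1 + t2 + t3 + t4 + t5)%N]].

End Levin.

(* Main.v *)
Require Import Defs.
From HB Require Import structures.
From mathcomp Require Import all_boot all_order all_algebra.
From mathcomp Require Import all_classical all_reals all_analysis.
From mathcomp Require Import complex.
From mathcomp Require Import ring lra zify.

(** On the grid [c_m = cos (m pi / N)], [N = nu + 1], the function [T_n] takes the
values [cos (m n pi / N)], and the frequencies [N + j] and [N - j] cannot be told
apart.  Hence multiplication by [x] acts on cosine coefficients as a tridiagonal
matrix [mulX_mx], the last column included, and so does [(1 - x^2) d/dx] on
[T_0, ..., T_nu] because [(1 - x^2) T_n' = n (x T_n - T_(n+1))] ([chebT_deriv]).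
The grid values of the weighted Levin operator are therefore
[values_mx *m levin_mx], where [levin_mx = D + i omega (1 - X^2) g'(X)] has half
bandwidth [d + 1].  Discrete orthogonality ([values_mx_inv]) says that
[values_mx] is inverted by the DCT-I up to diagonal factors, so one DCT turns
the system for grid values into a banded system for coefficients.

The weight [1 - x^2] makes both sides vanish at the two end points.  Since [N]
is odd, this forces a coefficient vector that is zero in positions [1 .. nu] to
be zero altogether ([ends_zero]): the equations for the coefficients [0] and [N]
follow from the others.  Replacing these two by [alpha_0 = 0] and [alpha_N = 0]
gives the square banded matrix [band_mx], whose solutions are exactly the
admissible solutions of the Levin system ([system_banded]).

Unique solvability.  After division by [i omega] the matrix is [band_mx t 1 g]
with [t = 1 / (i omega)].  At [t = 0] it is invertible: a combination [h] of
[T_1, ..., T_nu] in its kernel has [(1 - x^2) g' h] zero at the interior nodes,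
hence [h] is zero there, and [ends_zero] applies again ([values_inj]).  So the
determinant is a nonzero polynomial in [t], and [t] avoids its finitely many
roots once [omega] is large ([band_mx_large_unit]).

Cost.  Programs are assembled from fragments with a certified cost ([slp]).
- The DCT is a half sum of two chirp transforms.  By
  [2 m n = m^2 + n^2 - (m - n)^2] a chirp transform is a Toeplitz product between
  diagonal scalings ([slp_chirp]), and a Toeplitz product is a piece of a cyclic
  convolution of power of two length, done by the radix-2 FFT ([slp_toeplitz]).
  This works for every [nu].
- The system may be singular while still having a solution, so elimination has
  to keep the cost [d^2 nu] for every rank.  Rows are inserted one by one into an
  echelon form indexed by leading column ([insert_row]).  Row [i] is reduced only
  by pivots that come from earlier rows, so it stays in its own window of columns
  and there is no fill-in, however many rows vanish.  Free unknowns are set to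
  zero in the back substitution. *)

Set Implicit Arguments.
Unset Strict Implicit.
Unset Printing Implicit Defensive.
Import Order.TTheory GRing.Theory Num.Theory.
Import numFieldNormedType.Exports.
Local Open Scope ring_scope.
Local Open Scope complex_scope.

(** * Straight-line programs and their composition *)

Definition ticks (T : Type) (t : nat) (r : option (T * nat)) : option (T * nat) :=
  omap (fun u => (u.1, (t + u.2)%N)) r.

Lemma ticks0 (T : Type) (r : option (T * nat)) : ticks 0 r = r.
Proof. by case: r => [[a b]|]. Qed.

Lemma ticksD (T : Type) t t' (r : option (T * nat)) :
  ticks t (ticks t' r) = ticks (t + t') r.
Proof. by case: r => [[a b]|] //=; rewrite addnA. Qed.

Lemma tickE (T : Type) (r : option (T * nat)) : tick r = ticks 1 r.
Proof. by case: r => [[a b]|]. Qed.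

Section StraightLine.
Variable F : fieldType.
Implicit Types (mem ext : seq F) (q : prog F).

(** A straight-line fragment computing [m] values from inputs that sit in the
registers [ins i].  The fragment is a context [W] to be put in front of an
arbitrary continuation; it appends [e] registers and finds its results in the
registers [outs j].  The order of quantifiers makes [W] independent of the
contents of the memory.  Bounding [ins] and [outs] for all indices matters: a
register that does not exist yet reads as zero, and as something else once the
memory has grown. *)
Definition slp (I : Type) (m : nat) (Phi : (I -> F) -> nat -> F) (c : nat) :
    Prop :=
  forall (s : nat) (ins : I -> nat), (0 < s)%N -> (forall i, ins i < s)%N ->
  exists (W : prog F -> prog F) (e : nat) (outs : nat -> nat) (t : nat),
    [/\ (t <= c)%N, (forall j, outs j < s + e)%N &
     forall mem, size mem = s -> exists ext,
       [/\ size ext = e,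
           forall q, run (W q) mem = ticks t (run q (mem ++ ext)) &
           forall j, (j < m)%N ->
             (mem ++ ext)`_(outs j) = Phi (fun i => mem`_(ins i)) j]].

Lemma slp_weaken I m (Phi : (I -> F) -> nat -> F) c c' :
  (c <= c')%N -> slp m Phi c -> slp m Phi c'.
Proof.
move=> cc' sP s ins s0 hin; have [W [e [outs [t [h1 h2 h3]]]]] := sP s ins s0 hin.
by exists W, e, outs, t; split=> //; exact: leq_trans h1 cc'.
Qed.

Lemma slp_ext I m (Phi Psi : (I -> F) -> nat -> F) c :
  (forall x j, (j < m)%N -> Phi x j = Psi x j) -> slp m Phi c -> slp m Psi c.
Proof.
move=> eP sP s ins s0 hin; have [W [e [outs [t [h1 h2 h3]]]]] := sP s ins s0 hin.
exists W, e, outs, t; split=> // mem hm; have [ext [k1 k2 k3]] := h3 mem hm.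
by exists ext; split=> // j jm; rewrite k3 // eP.
Qed.

Lemma slp_var I (i : nat -> I) m : slp m (fun x j => x (i j)) 0.
Proof.
move=> s ins s0 hin; exists id, 0%N, (ins \o i), 0%N; split=> //.
  by move=> j; rewrite addn0 /=.
move=> mem hm; exists [::]; split=> //.
  by move=> q; rewrite cats0 ticks0.
by move=> j _; rewrite cats0.
Qed.

Lemma slp_const I (a : F) : slp 1 (fun (_ : I -> F) _ => a) 0.
Proof.
move=> s ins s0 hin; exists (Const a), 1%N, (fun=> s), 0%N; split=> //.
  by move=> j; rewrite addn1.
move=> mem hm; exists [:: a]; split=> //.
  by move=> q /=; rewrite cats1 ticks0.
by move=> j _; rewrite nth_cat hm ltnn subnn.
Qed.

Lemma slp_outs I m m' (Phi : (I -> F) -> nat -> F) c (f : nat -> nat) :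
  (forall j, j < m' -> f j < m)%N -> slp m Phi c ->
  slp m' (fun x j => Phi x (f j)) c.
Proof.
move=> hf sP s ins s0 hin; have [W [e [outs [t [h1 h2 h3]]]]] := sP s ins s0 hin.
exists W, e, (outs \o f), t; split=> // [j|mem hm]; first exact: h2.
have [ext [k1 k2 k3]] := h3 mem hm.
by exists ext; split=> // j jm; apply: k3; exact: hf.
Qed.

Lemma slp_ins I J m (Phi : (I -> F) -> nat -> F) c (f : I -> J) :
  slp m Phi c -> slp m (fun x => Phi (x \o f)) c.
Proof.
move=> sP s ins s0 hin.
have [W [e [outs [t [h1 h2 h3]]]]] := sP s (ins \o f) s0 (fun i => hin (f i)).
by exists W, e, outs, t; split.
Qed.

(** [Psi] sees only the [m] values that the first fragment promises, whence the
congruence hypothesis. *)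
Lemma slp_comp I m m' (Phi : (I -> F) -> nat -> F)
    (Psi : (nat -> F) -> nat -> F) c c' :
  (forall x y, (forall i, (i < m)%N -> x i = y i) ->
     forall j, (j < m')%N -> Psi x j = Psi y j) ->
  slp m Phi c -> slp m' Psi c' -> slp m' (fun x => Psi (Phi x)) (c + c').
Proof.
move=> eP sP sQ s ins s0 hin.
have [W [e [outs [t [h1 h2 h3]]]]] := sP s ins s0 hin.
have s1 : (0 < s + e)%N by rewrite ltn_addr.
have [W' [e' [outs' [t' [h1' h2' h3']]]]] := sQ (s + e)%N outs s1 h2.
exists (W \o W'), (e + e')%N, outs', (t + t')%N; split.
- exact: leq_add.
- by move=> j; rewrite addnA.
move=> mem hm; have [ext [k1 k2 k3]] := h3 mem hm.
have hm' : size (mem ++ ext) = (s + e)%N by rewrite size_cat hm k1.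
have [ext' [k1' k2' k3']] := h3' _ hm'.
exists (ext ++ ext'); split; first by rewrite size_cat k1 k1'.
- by move=> q /=; rewrite k2 k2' ticksD catA.
by move=> j jm; rewrite catA k3' //; apply: eP => // i im; rewrite k3.
Qed.

Lemma slp_cat I m m' (Phi Psi : (I -> F) -> nat -> F) c c' :
  slp m Phi c -> slp m' Psi c' ->
  slp (m + m') (fun x j => if (j < m)%N then Phi x j else Psi x (j - m)%N)
      (c + c').
Proof.
move=> sP sQ s ins s0 hin.
have [W [e [outs [t [h1 h2 h3]]]]] := sP s ins s0 hin.
have s1 : (0 < s + e)%N by rewrite ltn_addr.
have [W' [e' [outs' [t' [h1' h2' h3']]]]] :=
  sQ (s + e)%N ins s1 (fun i => ltn_addr _ (hin i)).
exists (W \o W'), (e + e')%N,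
  (fun j => if (j < m)%N then outs j else outs' (j - m)%N), (t + t')%N; split.
- exact: leq_add.
- by move=> j; rewrite addnA; case: ifP => // _; exact: ltn_addr.
move=> mem hm; have [ext [k1 k2 k3]] := h3 mem hm.
have hm' : size (mem ++ ext) = (s + e)%N by rewrite size_cat hm k1.
have [ext' [k1' k2' k3']] := h3' _ hm'.
exists (ext ++ ext'); split; first by rewrite size_cat k1 k1'.
- by move=> q /=; rewrite k2 k2' ticksD catA.
move=> j jm; rewrite catA; case: ifP => jm1; last first.
  rewrite k3'; last by rewrite ltn_subLR // leqNgt jm1.
  by congr Psi; apply/funext => i; rewrite nth_cat hm hin.
by rewrite nth_cat hm' h2 k3.
Qed.

Lemma slp_par I m (Phi : (I -> F) -> nat -> F) (c : nat -> nat) :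
  (forall j, (j < m)%N -> slp 1 (fun x _ => Phi x j) (c j)) ->
  slp m Phi (\sum_(j < m) c j).
Proof.
elim: m => [_|m IH hP].
  rewrite big_ord0 => s ins s0 hin.
  exists id, 0%N, (fun=> 0%N), 0%N; split=> // [j|mem hm]; first by rewrite addn0.
  by exists [::]; split=> // q; rewrite cats0 ticks0.
rewrite big_ord_recr /= -addn1.
have sm : slp m Phi (\sum_(j < m) c j) by apply: IH => j jm; apply: hP; exact: ltnW.
apply: slp_ext (slp_cat sm (hP m (ltnSn m))) => x j.
by rewrite addn1 ltnS leq_eqVlt => /orP[/eqP ->|->//]; rewrite ltnn.
Qed.

Lemma slp_map I m (Phi : (I -> F) -> nat -> F) c :
  (forall j, (j < m)%N -> slp 1 (fun x _ => Phi x j) c) -> slp m Phi (m * c).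
Proof.
by move=> /(slp_par (c := fun=> c)); rewrite sum_nat_const card_ord.
Qed.

Lemma slp_op I (o : arith_op) (op : F -> F -> F) (Phi Psi : (I -> F) -> nat -> F)
    c c' :
  (forall x y, arith o x y = Some (op x y)) ->
  slp 1 Phi c -> slp 1 Psi c' ->
  slp 1 (fun x j => op (Phi x j) (Psi x j)) (c + c').+1.
Proof.
move=> ho sP sQ.
have sO : slp 1 (fun (x : nat -> F) (j : nat) => op (x 0%N) (x 1%N)) 1.
  move=> s ins s0 hin.
  exists (Arith o (ins 0%N) (ins 1%N)), 1%N, (fun=> s), 1%N; split=> //.
    by move=> j; rewrite addn1.
  move=> mem hm; exists [:: op mem`_(ins 0%N) mem`_(ins 1%N)]; split=> //.
    by move=> q /=; rewrite ho tickE cats1.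
  by move=> j _; rewrite nth_cat hm ltnn subnn.
rewrite -[(c + c').+1]addn1; apply: slp_ext (slp_comp _ (slp_cat sP sQ) sO).
  by move=> x [|//] _.
by move=> x y hxy j _; rewrite !hxy.
Qed.

Lemma slp_add I (Phi Psi : (I -> F) -> nat -> F) c c' :
  slp 1 Phi c -> slp 1 Psi c' ->
  slp 1 (fun x j => Phi x j + Psi x j) (c + c').+1.
Proof. exact: (@slp_op _ Add). Qed.

Lemma slp_sub I (Phi Psi : (I -> F) -> nat -> F) c c' :
  slp 1 Phi c -> slp 1 Psi c' ->
  slp 1 (fun x j => Phi x j - Psi x j) (c + c').+1.
Proof. exact: (@slp_op _ Defs.Sub (fun a b => a - b)). Qed.

Lemma slp_mul I (Phi Psi : (I -> F) -> nat -> F) c c' :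
  slp 1 Phi c -> slp 1 Psi c' ->
  slp 1 (fun x j => Phi x j * Psi x j) (c + c').+1.
Proof. exact: (@slp_op _ Mul). Qed.

Lemma slp_scale I (a : F) (Phi : (I -> F) -> nat -> F) c :
  slp 1 Phi c -> slp 1 (fun x j => a * Phi x j) c.+1.
Proof. by move=> sP; exact: slp_mul (@slp_const I a) sP. Qed.

Lemma slp_sum I n (Phi : nat -> (I -> F) -> nat -> F) c :
  (forall k, (k < n)%N -> slp 1 (Phi k) c) ->
  slp 1 (fun x j => \sum_(k < n) Phi k x j) (n * c.+1).
Proof.
elim: n => [_|n IH hP].
  by apply: slp_ext (@slp_const I 0) => x j _; rewrite big_ord0.
apply: (@slp_weaken _ _ _ (n * c.+1 + c).+1); first by lia.
apply: slp_ext (slp_add (IH _) (hP n (ltnSn n))) => [x j _|k kn].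
  by rewrite big_ord_recr.
by apply: hP; exact: ltnW.
Qed.

(** The passage from fragments to whole programs; indices beyond the input are
redirected to register [0], which the congruence hypothesis makes harmless. *)
Lemma slp_prog n m (Phi : (nat -> F) -> nat -> F) c : (0 < n)%N ->
  (forall x y, (forall i, (i < n)%N -> x i = y i) ->
     forall j, (j < m)%N -> Phi x j = Phi y j) ->
  slp m Phi c ->
  exists (p : prog F) (t : nat), (t <= c)%N /\
   forall mem, size mem = n ->
     run p mem = Some (mkseq (Phi (nth 0 mem)) m, t).
Proof.
move=> n0 dep sP.
pose ins i := if (i < n)%N then i else 0%N.
have hin i : (ins i < n)%N by rewrite /ins; case: ifP.
have [W [e [outs [t [h1 h2 h3]]]]] := sP n ins n0 hin.
exists (W (Return F (mkseq outs m))), t; split=> // mem hm.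
have [ext [k1 k2 k3]] := h3 mem hm.
rewrite k2 /= addn0; congr (Some (_, t)).
rewrite -map_comp /mkseq; apply/eq_in_map => j; rewrite mem_iota add0n => /andP[_ jm] /=.
by rewrite k3 //; apply: dep => // i; rewrite /ins => ->.
Qed.

End StraightLine.

(** * Fast Fourier transform and Toeplitz products *)

Section FFT.
Variable F : fieldType.

Definition dft (z : F) (n : nat) (x : nat -> F) (m : nat) : F :=
  \sum_(k < n) z ^+ (m * k) * x k.

Lemma sum_even_odd (f : nat -> F) n :
  \sum_(k < n.*2) f k = \sum_(k < n) f k.*2 + \sum_(k < n) f k.*2.+1.
Proof.
elim: n => [|n IH]; first by rewrite !big_ord0 addr0.
rewrite doubleS !big_ord_recr /= IH; ring.
Qed.

(** Splitting the sum by parity of the index reduces length [2^(r+1)] to two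
transforms of length [2^r] with root [z^2]; both have period [2^r] in [m], while
[z^(m + 2^r) = - z^m] gives the second half of the output. *)
Lemma slp_fft r (z : F) : ((0 < r)%N -> z ^+ (2 ^ r.-1) = -1) ->
  slp (2 ^ r) (dft z (2 ^ r)) (4 * r * 2 ^ r).
Proof.
elim: r z => [|r IH] z hz.
  apply: slp_ext (slp_var F (fun=> 0%N) 1) => x j.
  by rewrite ltnS leqn0 => /eqP ->; rewrite /dft big_ord1 mul0n expr0 mul1r.
have {}hz : z ^+ (2 ^ r) = -1 by apply: hz.
have hz2 : (0 < r)%N -> (z ^+ 2) ^+ (2 ^ r.-1) = -1.
  by case: r hz {IH} => // r hz _; rewrite -exprM -expnS.
have sE := slp_ins (fun k => k.*2) (IH _ hz2).
have sO := slp_ins (fun k => k.*2.+1) (IH _ hz2).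
set L := (2 ^ r)%N in hz IH sE sO *.
have sB : slp (L + L) (fun (x : nat -> F) j =>
   if (j < L)%N then x j + z ^+ j * x (L + j)%N
   else x (j - L)%N - z ^+ (j - L) * x j) ((L + L) * 2).
  apply: slp_map => j _ /=; case: (j < L)%N.
  - exact: slp_add (slp_var F (fun=> j) 1) (slp_scale _ (slp_var F (fun=> (L + j)%N) 1)).
  - exact: slp_sub (slp_var F (fun=> (j - L)%N) 1) (slp_scale _ (slp_var F (fun=> j) 1)).
have L0 : (0 < L)%N by rewrite expn_gt0.
have L2 : (2 ^ r.+1 = L.*2)%N by rewrite expnS mul2n.
have zL : (z ^+ 2) ^+ L = 1 by rewrite -exprM mulnC exprM hz sqrrN expr1n.
have per (u : nat -> F) m : dft (z ^+ 2) L u (m + L) = dft (z ^+ 2) L u m.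
  apply: eq_bigr => k _; congr (_ * _).
  by rewrite mulnDl exprD [X in _ * X]exprM zL expr1n mulr1.
have split_dft x m : dft z L.*2 x m =
    dft (z ^+ 2) L (fun k => x k.*2) m + z ^+ m * dft (z ^+ 2) L (fun k => x k.*2.+1) m.
  rewrite /dft (sum_even_odd (fun k => z ^+ (m * k) * x k)) mulr_sumr.
  congr (_ + _); apply: eq_bigr => k _; rewrite -exprM.
    by congr (z ^+ _ * _); rewrite -mul2n mulnCA.
  by rewrite mulrA -exprD; congr (z ^+ _ * _); rewrite -mul2n mulnS mulnCA.
rewrite L2 -addnn.
apply: (@slp_weaken _ _ _ _ ((4 * r * L + 4 * r * L) + (L + L) * 2)); first by lia.
apply: slp_ext (slp_comp _ (slp_cat sE sO) sB) => [x j jL|x y hxy j jL].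
  rewrite addnn split_dft; case: (ltnP j L) => jL1.
    by rewrite ltnNge leq_addr /= addKn.
  have jL2 : (j - L < L)%N by rewrite ltn_subLR.
  have pj u : dft (z ^+ 2) L u j = dft (z ^+ 2) L u (j - L).
    by rewrite -{1}(subnK jL1) per.
  have zj : z ^+ j = - z ^+ (j - L) by rewrite -{1}(subnK jL1) exprD hz mulrN1.
  by rewrite jL2 !pj zj mulNr.
by case: (ltnP j L) => jL1; rewrite !hxy //; lia.
Qed.

Lemma sum_expr_root1 n (z : F) : z ^+ n = 1 -> z != 1 -> \sum_(k < n) z ^+ k = 0.
Proof.
move=> zn z1; apply/eqP; have /eqP := subrX1 z n.
by rewrite zn subrr eq_sym mulf_eq0 subr_eq0 (negPf z1).
Qed.

(** The order of [z] divides [2^(r+1)]; if it were smaller it would divide [2^r]. *)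
Lemma pow2_prim_root r (z : F) : (2 : F) != 0 ->
  z ^+ (2 ^ r) = -1 -> (2 ^ r.+1).-primitive_root z.
Proof.
move=> nz2 hz.
have z1 : z ^+ (2 ^ r.+1) = 1 by rewrite expnS mulnC exprM hz sqrrN expr1n.
have [m pm] := prim_order_exists (expn_gt0 2 r.+1) z1.
case/(dvdn_pfactor _ _ (isT : prime 2)) => k kr mE; rewrite mE in pm.
move: kr; rewrite leq_eqVlt => /orP[/eqP <- //|]; rewrite ltnS => kr.
have := prim_expr_order pm => /(congr1 (fun u => u ^+ (2 ^ (r - k)))).
rewrite -exprM -expnD subnKC // hz expr1n => /eqP.
by rewrite eq_sym -subr_eq0 opprK (negPf nz2).
Qed.

(** The convolution theorem: the inverse transform of a product of transforms is
the cyclic convolution, by orthogonality of the powers of a primitive root. *)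
Lemma dft_inverse_conv L (z : F) (tau v : nat -> F) s :
  L%:R != 0 :> F -> L.-primitive_root z ->
  dft z^-1 L (fun j => (dft z L tau j / L%:R) * dft z L v j) s
  = \sum_(k < L) \sum_(l < L) (l + k == s %[mod L])%:R * (tau l * v k).
Proof.
move=> nzL pz; have zu : z \is a GRing.unit.
  by rewrite unitfE; apply/negP=> /eqP z0; have := prim_expr_order pz;
     rewrite z0 expr0n (gtn_eqF (prim_order_gt0 pz)) => /eqP; rewrite eq_sym oner_eq0.
have orth l k : \sum_(j < L) z^-1 ^+ (s * j) * (z ^+ (j * l) / L%:R) * z ^+ (j * k)
    = (l + k == s %[mod L])%:R.
  pose w := z^-1 ^+ s * z ^+ (l + k).
  rewrite (eq_bigr (fun j : 'I_L => w ^+ j / L%:R)); last first.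
    by move=> j _; rewrite /w exprMn -!exprM mulnDl exprD (mulnC j l) (mulnC j k); ring.
  rewrite -mulr_suml -(eq_prim_root_expr pz).
  have wE : (w == 1) = (z ^+ (l + k) == z ^+ s).
    rewrite /w exprVn mulrC -subr_eq0 -(mulrV (unitrX s zu)) -mulrBl.
    by rewrite mulf_eq0 invr_eq0 expf_eq0 -[z == 0]negbK -unitfE zu andbF orbF subr_eq0.
  rewrite -wE; case: eqP => [->|/eqP w1].
    rewrite (eq_bigr (fun=> 1)) => [|j _]; last by rewrite expr1n.
    by rewrite sumr_const card_ord divff.
  rewrite sum_expr_root1 ?mul0r //.
  rewrite /w exprMn -!exprM mulnC (mulnC _ L) !exprM exprVn (prim_expr_order pz).
  by rewrite invr1 !expr1n mul1r.
transitivity (\sum_(j < L) \sum_(k < L) \sum_(l < L)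
    z^-1 ^+ (s * j) * (z ^+ (j * l) / L%:R) * z ^+ (j * k) * (tau l * v k)).
  rewrite /dft; apply: eq_bigr => j _; rewrite !mulr_suml mulr_sumr.
  rewrite [RHS]exchange_big /=; apply: eq_bigr => l _.
  rewrite !mulr_sumr; apply: eq_bigr => k _; ring.
rewrite exchange_big /=; apply: eq_bigr => k _.
rewrite exchange_big /=; apply: eq_bigr => l _.
by rewrite -mulr_suml orth.
Qed.

(** A window of a cyclic convolution: for [m, k <= n] only [l = m + n - k] solves
[l + k = m + n] modulo [2^(r+1) > 2 n], so there is no wrap-around.  The transform
of [tau] consists of constants and costs nothing. *)
Lemma slp_toeplitz n r (z : F) (tau : nat -> F) :
  (2 : F) != 0 -> z ^+ (2 ^ r) = -1 -> (2 * n < 2 ^ r.+1)%N ->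
  slp n.+1 (fun (u : nat -> F) m => \sum_(k < n.+1) tau (m + n - k)%N * u k)
      ((8 * r + 9) * 2 ^ r.+1).
Proof.
move=> nz2 hz; set L := (2 ^ r.+1)%N => nL.
have pz : L.-primitive_root z by exact: pow2_prim_root.
have nzL : L%:R != 0 :> F by rewrite natrX expf_neq0.
have hzV : z^-1 ^+ (2 ^ r) = -1 by rewrite exprVn hz invrN1.
have sP : slp L (fun (u : nat -> F) j => if (j < n.+1)%N then u j else 0) (L * 0).
  apply: slp_map => j _ /=; case: (j < n.+1)%N; last exact: slp_const.
  exact: (slp_var F (fun=> j) 1).
have sK : slp L (fun (x : nat -> F) j => dft z L tau j / L%:R * x j) (L * 1).
  by apply: slp_map => j _; exact: slp_scale (slp_var F (fun=> j) 1).
have dep w (x y : nat -> F) : (forall i, (i < L)%N -> x i = y i) ->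
    forall j, (j < L)%N -> dft w L x j = dft w L y j.
  by move=> xy j _; apply: eq_bigr => k _; rewrite xy.
have s1 := slp_comp (dep z) sP (@slp_fft r.+1 z (fun=> hz)).
have s2 := slp_comp _ s1 sK.
have {}s2 := s2 (fun x y xy j jL => congr1 _ (xy j jL)).
have s3 := slp_comp (dep z^-1) s2 (@slp_fft r.+1 z^-1 (fun=> hzV)).
have s4 := slp_outs (m' := n.+1) (f := fun m => (m + n)%N) _ s3.
apply: (@slp_weaken _ _ _ _ (L * 0 + 4 * r.+1 * L + L * 1 + 4 * r.+1 * L)); first by lia.
apply: slp_ext (s4 _) => [u m mn|j jn]; last by lia.
rewrite dft_inverse_conv //.
transitivity (\sum_(k < L) tau (m + n - k)%N * (if (k < n.+1)%N then u k else 0)).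
  apply: eq_bigr => k _; case: ltnP => kn; last first.
    by rewrite mulr0 big1 // => l _; rewrite !mulr0.
  have lL : (m + n - k < L)%N by lia.
  rewrite (bigD1 (Ordinal lL)) //= subnK; last by lia.
  rewrite eqxx mul1r big1 ?addr0 // => l lne.
  case: eqP => [h|_]; last by rewrite mul0r.
  case/eqP: lne; apply/val_inj => /=.
  have lL' := ltn_ord l; have kL' := ltn_ord k.
  move: h; rewrite [RHS]modn_small; last by lia.
  case: (ltnP (l + k) L) => lk; first by rewrite modn_small //; lia.
  rewrite -(subnK lk) modnDr modn_small; lia.
have nL' : (n.+1 <= L)%N by lia.
rewrite [RHS](big_ord_widen L (fun k => tau (m + n - k)%N * u k) nL') [RHS]big_mkcond /=.
by apply: eq_bigr => k _; case: ifP => // _; rewrite mulr0.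
Qed.

End FFT.

(** * The DCT-I by chirp transforms *)

Section DCT.
Variable R : realType.
Implicit Types (a t : R).

Definition cis t : R[i] := cos t +i* sin t.

Lemma cisD s t : cis (s + t) = cis s * cis t.
Proof. by rewrite /cis cosD sinD; simpc; congr (_ +i* _); ring. Qed.

Lemma cos_cis t : (cos t)%:C = 2^-1 * cis t + 2^-1 * cis (- t).
Proof.
have n2 : (2 : R[i]) != 0 by rewrite pnatr_eq0.
apply: (mulfI n2); rewrite -mulrDr mulVKf // mulr_natl mulr2n /cis cosN sinN.
by apply/eqP; rewrite eq_complex /= subrr addr0 !eqxx.
Qed.

Lemma two_neq0 : (2 : R[i]) != 0. Proof. by rewrite pnatr_eq0. Qed.

(** Bluestein's device, [2 m k = m^2 + k^2 - (m - k)^2].  The kernel of the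
Toeplitz product is shifted by [n] to be indexed by naturals. *)
Lemma slp_chirp a n r : (2 * n < 2 ^ r.+1)%N ->
  slp n.+1 (fun (u : nat -> R[i]) m =>
     \sum_(k < n.+1) cis (a * (2 * m * k)%:R) * u k)
    (n.+1 + (8 * r + 9) * 2 ^ r.+1 + n.+1).
Proof.
move=> nr.
(* any such root drives the FFT; it is unrelated to the angle a *)
have [z hz] : exists z : R[i], z ^+ (2 ^ r) = -1.
  by exists ((2 ^ r).-root (-1)); rewrite rootCK // expn_gt0.
pose tau l := cis (- a * (l%:R - n%:R) ^+ 2).
have sS : slp n.+1 (fun (x : nat -> R[i]) j => cis (a * j%:R ^+ 2) * x j) (n.+1 * 1).
  by apply: slp_map => j _; exact: slp_scale (slp_var _ (fun=> j) 1).
have s1 := slp_comp _ sS (slp_toeplitz tau two_neq0 hz nr).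
have {}s1 := s1 _; have s2 := slp_comp _ (s1 _) sS.
rewrite muln1 in s2; apply: slp_ext (s2 _ _) => [u m mn|x y xy j jn|x y xy j jn].
- rewrite mulr_sumr; apply: eq_bigr => k _.
  rewrite mulrA mulrA -!cisD; congr (cis _ * _).
  have kn := ltn_ord k.
  rewrite natrB ?natrD ?natrM; last by lia.
  ring.
- by rewrite xy.
- by apply: eq_bigr => k _; rewrite xy.
Qed.

Definition trap_weight (n k : nat) : R := if (0 < k < n)%N then 1 else 2^-1.

Lemma cos_natpi m : cos (m%:R * pi) = (-1) ^+ m :> R.
Proof.
elim: m => [|m IH]; first by rewrite mul0r cos0.
by rewrite -natr1 mulrDl mul1r cosDpi IH exprS mulN1r.
Qed.

Lemma sin_natpi m : sin (m%:R * pi) = 0 :> R.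
Proof.
elim: m => [|m IH]; first by rewrite mul0r sin0.
by rewrite -natr1 mulrDl mul1r sinDpi IH oppr0.
Qed.

Lemma sum_ends (V : nmodType) nu (f : 'I_nu.+2 -> V) :
  \sum_k f k = f ord0 + \sum_(k < nu.+2 | (0 < k < nu.+1)%N) f k + f ord_max.
Proof.
rewrite (bigD1 ord0) //= (bigD1 ord_max) //= -addrA; congr (_ + _).
rewrite addrC; congr (_ + _); apply: eq_bigl => k.
by rewrite -!val_eqE /= lt0n; have := ltn_ord k; lia.
Qed.

Lemma dct1E nu (x : 'cV[R[i]]_nu.+2) m :
  dct1 x m ord0 = \sum_(k < nu.+2) (trap_weight nu.+1 k)%:C *
     (cos ((m * k)%:R * pi / nu.+1%:R))%:C * x k ord0.
Proof.
rewrite mxE sum_ends /= /trap_weight ltnn /= muln0 !mul0r cos0 mulr1.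
have -> : (m * nu.+1)%:R * pi / nu.+1%:R = m%:R * pi :> R.
  by rewrite natrM mulrAC mulfK // pnatr_eq0.
rewrite ltnn cos_natpi rmorphXn /= rmorphN1 fmorphV rmorph_nat.
congr (_ + _ + _); apply: eq_bigr => k ->.
by rewrite mul1r.
Qed.

(** The cosine is the half sum of the chirps with opposite angles. *)
Lemma slp_dct nu r : (2 * nu.+1 < 2 ^ r.+1)%N ->
  slp nu.+2 (fun (x : nat -> R[i]) m => \sum_(k < nu.+2) (trap_weight nu.+1 k)%:C *
     (cos ((m * k)%:R * pi / nu.+1%:R))%:C * x k)
    (2 * ((8 * r + 9) * 2 ^ r.+1) + 8 * nu.+2).
Proof.
move=> nr; pose a : R := pi / nu.+1%:R / 2.
have sS : slp nu.+2 (fun (x : nat -> R[i]) j =>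
    (2^-1 * (trap_weight nu.+1 j)%:C) * x j) (nu.+2 * 1).
  by apply: slp_map => j _; exact: slp_scale (slp_var _ (fun=> j) 1).
have sC := slp_cat (slp_chirp a nr) (slp_chirp (- a) nr).
have s1 := slp_comp _ sS sC.
have sA : slp nu.+2 (fun (x : nat -> R[i]) j => x j + x (nu.+2 + j)%N) (nu.+2 * 1).
  apply: slp_map => j _; exact: slp_add (slp_var _ (fun=> j) 1) (slp_var _ (fun=> _) 1).
have s2 := slp_comp _ (s1 _) sA.
apply: (slp_weaken _ (slp_ext _ (s2 _ _))); first by lia.
- move=> x m mn; rewrite mn ltnNge leq_addr /= addKn -big_split.
  apply: eq_bigr => k _ /=; rewrite cos_cis.
  have -> : (m * k)%:R * pi / nu.+1%:R = a * (2 * m * k)%:R :> R.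
    by rewrite /a !natrM; move: (nu.+1%:R^-1) => u; field.
  by rewrite mulNr; ring.
- by move=> x y xy j jn; rewrite !xy //; lia.
- by move=> x y xy j jn /=; case: (j < nu.+2)%N; apply: eq_bigr => k _; rewrite xy.
Qed.

End DCT.

(** * Banded elimination, one row at a time *)

Section BandElimination.
Variable F : fieldType.
Implicit Types (mem ext : seq F) (x : nat -> F).

(** The equation [sum_(lo <= c < hi) a_c x_c = y] whose coefficients and right-hand
side are stored in registers.  Coefficients outside the window count as zero
without being stored. *)
Record equation := Equation { lo : nat; hi : nat; reg : nat -> nat; rhs : nat }.

Definition holds mem (e : equation) x :=
  \sum_(lo e <= c < hi e) mem`_(reg e c) * x c = mem`_(rhs e).

Definition regs_below (s : nat) (e : equation) :=
  (forall c, reg e c < s)%N /\ (rhs e < s)%N.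

Lemma regs_below_leq s s' e : (s <= s')%N -> regs_below s e -> regs_below s' e.
Proof. by move=> ss [h1 h2]; split=> [c|]; exact: leq_trans ss. Qed.

Lemma nth_cat_lt mem ext i : (i < size mem)%N -> (mem ++ ext)`_i = mem`_i.
Proof. by move=> h; rewrite nth_cat h. Qed.

Lemma holds_cat mem ext e x :
  regs_below (size mem) e -> holds (mem ++ ext) e x <-> holds mem e x.
Proof.
move=> [h1 h2]; rewrite /holds nth_cat_lt //.
by under eq_bigr do rewrite nth_cat_lt //.
Qed.

Variable w : nat.

Definition pivots_ok (s H : nat) (piv : nat -> option equation) :=
  forall c p, piv c = Some p ->
    [/\ lo p = c, (c < hi p)%N, (hi p <= H)%N, (hi p <= c + w)%N & regs_below s p].

Definition pivots_nz mem (piv : nat -> option equation) :=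
  forall c p, piv c = Some p -> mem`_(reg p c) != 0.

Lemma pivots_ok_leq s s' H H' piv : (s <= s')%N -> (H <= H')%N ->
  pivots_ok s H piv -> pivots_ok s' H' piv.
Proof.
move=> ss hh ok c p /ok [h1 h2 h3 h4 h5]; split=> //; first exact: leq_trans hh.
exact: regs_below_leq h5.
Qed.

Lemma pivots_nz_cat mem ext H piv : pivots_ok (size mem) H piv ->
  pivots_nz mem piv -> pivots_nz (mem ++ ext) piv.
Proof.
move=> ok nz c p hp; have [_ _ _ _ [h _]] := ok c p hp.
by rewrite nth_cat_lt //; exact: nz.
Qed.

(** Induction on the number [k] of unknowns still to be determined; [xr c] is the
register that holds the unknown [c >= k].  A column without pivot belongs to a
free unknown, which is set to zero. *)
Lemma back_substitution n piv k s (xr : nat -> nat) :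
  (k <= n)%N -> (0 < s)%N -> (forall c, xr c < s)%N -> pivots_ok s n piv ->
  exists p : prog F, forall mem, size mem = s -> pivots_nz mem piv ->
    exists x t, [/\ run p mem = Some (mkseq x n, t), (t <= k * (2 * w + 2))%N,
      forall c, (k <= c < n)%N -> x c = mem`_(xr c) &
      forall c q, (c < k)%N -> piv c = Some q -> holds mem q x].
Proof.
elim: k s xr => [|k IH] s xr kn s0 hxr ok.
  exists (Return F (mkseq xr n)) => mem hm nz.
  exists (fun c => mem`_(xr c)), 0%N; split=> //=.
  by congr (Some (_, _)); rewrite /mkseq -map_comp.
case pivk: (piv k) => [q|]; last first.
  pose xr' (c : nat) := if c == k then s else xr c.
  have hxr' c : (xr' c < s.+1)%N.
    by rewrite /xr'; case: eqP => // _; rewrite ltnS ltnW.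
  have [p hp] := IH s.+1 xr' (ltnW kn) isT hxr'
    (pivots_ok_leq (leqnSn s) (leqnn n) ok).
  exists (Const 0 p) => mem hm nz.
  have hok : pivots_ok (size mem) n piv by rewrite hm.
  have hm' : size (mem ++ [:: 0]) = s.+1 by rewrite size_cat hm addn1.
  have [x [t [h1 h2 h3 h4]]] := hp _ hm' (pivots_nz_cat _ hok nz).
  exists x, t; rewrite /= -cats1; split=> //.
  - by apply: leq_trans h2 _; rewrite leq_mul2r leqnSn orbT.
  - move=> c /andP[kc cn]; rewrite h3 ?(ltnW kc) // /xr' gtn_eqF //.
    by rewrite nth_cat_lt ?hm.
  - move=> c q; rewrite ltnS leq_eqVlt => /orP[/eqP ->|ck hq]; first by rewrite pivk.
    by apply/(holds_cat [:: 0]); [have [_ _ _ _] := hok _ _ hq | exact: h4 hq].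
have [loq khi hin hiw [wfq1 wfq2]] := ok k q pivk.
pose ins (i : option (bool * nat)) := match i with
  | None => rhs q | Some (true, c) => reg q c | Some (false, c) => xr c end.
have hins i : (ins i < s)%N by case: i => [[[] c]|]; rewrite /ins ?wfq1 ?hxr.
have sP : slp 1 (fun (y : option (bool * nat) -> F) _ => y None -
    \sum_(i < hi q - k.+1) y (Some (true, k.+1 + i)%N) * y (Some (false, k.+1 + i)%N))
    (0 + (hi q - k.+1) * 2).+1.
  apply: slp_sub (slp_var F (fun=> None) 1) _.
  apply: (slp_sum (Phi := fun i (y : option (bool * nat) -> F) _ =>
    y (Some (true, k.+1 + i)%N) * y (Some (false, k.+1 + i)%N))) => i _.
  exact: slp_mul (slp_var F (fun=> _) 1) (slp_var F (fun=> _) 1).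
have [W [e [outs [t0 [ht0 houts hW]]]]] := sP s ins s0 hins.
pose xr' (c : nat) := if c == k then (s + e)%N else xr c.
have hxr' c : (xr' c < (s + e).+1)%N.
  by rewrite /xr'; case: eqP => // _; rewrite ltnS ltnW // ltn_addr.
have le_s : (s <= (s + e).+1)%N by rewrite -addnS leq_addr.
have [p hp] := IH (s + e).+1 xr' (ltnW kn) isT hxr' (pivots_ok_leq le_s (leqnn n) ok).
exists (W (Arith Div (outs 0%N) (reg q k) p)) => mem hm nz.
have hok : pivots_ok (size mem) n piv by rewrite hm.
have [ext [k1 k2 k3]] := hW mem hm.
have hq0 : mem`_(reg q k) != 0 by apply: nz.
have qk : (mem ++ ext)`_(reg q k) = mem`_(reg q k) by rewrite nth_cat_lt ?hm.
pose z := (mem ++ ext)`_(outs 0%N) / mem`_(reg q k).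
have hm' : size (mem ++ (ext ++ [:: z])) = (s + e).+1.
  by rewrite !size_cat hm k1 addn1 addnS.
have [x [t [h1 h2 h3 h4]]] := hp _ hm' (pivots_nz_cat _ hok nz).
exists x, (t0 + t.+1)%N; split.
- by rewrite k2 /= qk (negPf hq0) -/z -cats1 -catA h1.
- by nia.
- move=> c /andP[kc cn]; rewrite h3 ?(ltnW kc) // /xr' gtn_eqF //.
  by rewrite nth_cat_lt ?hm.
move=> c q'; rewrite ltnS leq_eqVlt => /orP[/eqP ->|ck hq]; last first.
  by apply/(holds_cat (ext ++ [:: z])); [have [_ _ _ _] := hok _ _ hq | exact: h4 hq].
rewrite pivk => -[<-]; rewrite /holds loq big_ltn //.
have -> : x k = z.
  rewrite h3 ?leqnn // /xr' eqxx catA nth_cat size_cat hm k1 ltnn subnn //.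
rewrite /z k3 // mulrC divfK //=; apply/eqP; rewrite addrAC subr_eq; apply/eqP.
congr (_ + _); rewrite -(add0n k.+1) big_addn add0n big_mkord.
apply: eq_bigr => j _; rewrite addnC h3 /xr'; last by have := ltn_ord j; lia.
by rewrite gtn_eqF ?nth_cat_lt ?hm //; lia.
Qed.

(** The invariant of the insertion phase: its set of solutions never changes. *)
Definition pending_system (rows : nat -> equation) (m : nat) mem
    (piv : nat -> option equation) i x :=
  (forall c p, piv c = Some p -> holds mem p x) /\
  (forall j, (i <= j < m)%N -> holds mem (rows j) x).

Lemma pending_system_cat rows m mem ext H piv i x :
  pivots_ok (size mem) H piv -> (forall j, regs_below (size mem) (rows j)) ->
  pending_system rows m (mem ++ ext) piv i x <-> pending_system rows m mem piv i x.
Proof.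
move=> ok wfr; split=> -[h1 h2]; split=> [c p hp|j ij].
- by have [_ _ _ _ hw] := ok c p hp; apply/(holds_cat ext) => //; exact: h1 hp.
- by apply/(holds_cat ext) => //; exact: h2.
- by have [_ _ _ _ hw] := ok c p hp; apply/(holds_cat ext) => //; exact: h1 hp.
- by apply/(holds_cat ext) => //; exact: h2.
Qed.

Variables (n m s0 : nat) (rows : nat -> equation).
Hypothesis s0_gt0 : (0 < s0)%N.
Hypothesis wf_rows : forall j, regs_below s0 (rows j).
Hypothesis hi_rows_n : forall j, (hi (rows j) <= n)%N.
Hypothesis hi_rows_w : forall j, (hi (rows j) <= lo (rows j) + w)%N.
Hypothesis lo_hi_rows : forall j, (j < m)%N -> (lo (rows j) <= hi (rows j))%N.
Hypothesis hi_rows_mono : forall i j, (i <= j)%N -> (hi (rows i) <= hi (rows j))%N.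

Definition eliminable s piv i c :=
  exists p : prog F, forall mem, size mem = s -> pivots_nz mem piv ->
    (exists x, pending_system rows m mem piv i x) ->
    exists x t, [/\ run p mem = Some (mkseq x n, t), (t <= c)%N &
      pending_system rows m mem piv i x].

(** Induction on the length [l] of the window of the current equation.  A zero
leading coefficient shortens the window; a nonzero one either becomes a pivot, or
is eliminated by the pivot of that column.  The window of such a pivot ends no
later than [hi e], as it stems from an earlier row, so the right end of the
window never moves.  An equation with empty window reads [0 = y] and can be
dropped, as the system is assumed to have a solution.  In every case the set of
solutions is unchanged. *)
Lemma insert_row i c : (i < m)%N ->
  (forall s piv, (s0 <= s)%N -> pivots_ok s (hi (rows i)) piv ->
     eliminable s piv i.+1 c) ->
  forall l e s piv, (hi e - lo e)%N = l -> (s0 <= s)%N -> regs_below s e ->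
    hi e = hi (rows i) -> (lo e <= hi e)%N -> (hi e <= lo e + w)%N ->
    pivots_ok s (hi e) piv ->
  exists p : prog F, forall mem, size mem = s -> pivots_nz mem piv ->
    (exists x, holds mem e x /\ pending_system rows m mem piv i.+1 x) ->
    exists x t, [/\ run p mem = Some (mkseq x n, t), (t <= l * (2 * w + 2) + c)%N,
      holds mem e x & pending_system rows m mem piv i.+1 x].
Proof.
move=> im outer; elim=> [|l IH] e s piv hl s0s wfe hie lohi hiw ok.
  rewrite hie in ok; have [p hp] := outer s piv s0s ok.
  exists p => mem hm nz [x0 [he0 hs0]].
  have [x [t [h1 h2 h3]]] := hp mem hm nz (ex_intro _ x0 hs0).
  exists x, t; split=> //.
  by move: he0; rewrite /holds !big_geq //; lia.
have lthi : (lo e < hi e)%N by lia.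
have [wfe1 wfe2] := wfe.
have wfr j : regs_below s (rows j) by exact: regs_below_leq (wf_rows j).
(* leading coefficient zero: the same registers with a shorter window *)
have [pz hpz] := IH (Equation (lo e).+1 (hi e) (reg e) (rhs e)) s piv
  (ltac:(rewrite /=; lia)) s0s wfe hie lthi (ltac:(rewrite /=; lia)) ok.
suff [pn hpn] : exists p : prog F, forall mem, size mem = s ->
    pivots_nz mem piv -> mem`_(reg e (lo e)) != 0 ->
    (exists x, holds mem e x /\ pending_system rows m mem piv i.+1 x) ->
    exists x t, [/\ run p mem = Some (mkseq x n, t),
      (t < l.+1 * (2 * w + 2) + c)%N,
      holds mem e x & pending_system rows m mem piv i.+1 x].
  exists (IfZero (reg e (lo e)) pz pn) => mem hm nz hx /=.
  case: eqP => [z0|/eqP nz0]; last first.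
    have [x [t [h1 h2 h3 h4]]] := hpn mem hm nz nz0 hx.
    by exists x, t.+1; rewrite h1.
  have hz x : holds mem e x <->
      holds mem (Equation (lo e).+1 (hi e) (reg e) (rhs e)) x.
    by rewrite /holds /= big_ltn // z0 mul0r add0r.
  have [|x [t [h1 h2 h3 h4]]] := hpz mem hm nz.
    by case: hx => x [/hz h h']; exists x.
  exists x, t.+1; rewrite h1; split=> //; first by lia.
  exact/hz.
case pivk: (piv (lo e)) => [q|]; last first.
  (* no pivot in this column yet: the equation becomes one *)
pose piv' (k : nat) := if k == lo e then Some e else piv k.
  have ok' : pivots_ok s (hi (rows i)) piv'.
    move=> k p; rewrite /piv'; case: eqP => [-> [<-]|_ hp]; first by rewrite -hie.
    by rewrite -hie; exact: ok.
  have [p hp] := outer s piv' s0s ok'.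
  have piv_eq mem x : pending_system rows m mem piv' i.+1 x <->
      holds mem e x /\ pending_system rows m mem piv i.+1 x.
    split=> [[h1 h2]|[h1 [h2 h3]]]; last first.
      split=> // k q; rewrite /piv'; case: eqP => [_ [<-] //|_]; exact: h2.
    split; first by apply: (h1 (lo e)); rewrite /piv' eqxx.
    split=> // k q hq; apply: (h1 k); rewrite /piv'; case: eqP => // ke.
    by rewrite ke pivk in hq.
  exists p => mem hm nz nz0 [x0 /piv_eq hx0].
  have nz' : pivots_nz mem piv'.
    by move=> k q; rewrite /piv'; case: eqP => [-> [<-]|_]; [exact: nz0|move=> hq; exact: nz hq].
  have [x [t [h1 h2 /piv_eq[h3 h4]]]] := hp mem hm nz' (ex_intro _ x0 hx0).
  exists x, t; split=> //; lia.
have [loq khi hin hiwq [wfq1 wfq2]] := ok _ q pivk.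
(* The multiple f = e_lo / q_lo of the pivot equation is subtracted; f sits in
   register s, index 0 stands for the right-hand sides and index j > 0 for
   column lo + j. *)
pose ins (k : option (bool * nat)) := match k with
  | None => s
  | Some (true, 0) => rhs e | Some (false, 0) => rhs q
  | Some (true, c.+1) => reg e (lo e + c.+1)
  | Some (false, c.+1) => reg q (lo e + c.+1) end.
have hins k : (ins k < s.+1)%N.
  by case: k => [[[] [|k]]|]; rewrite /ins // ltnS ltnW // ?wfe1 ?wfq1.
pose sub k := (lo e + k < hi q)%N.
have sP : slp l.+1 (fun (y : option (bool * nat) -> F) k =>
     if sub k then y (Some (true, k)) - y None * y (Some (false, k))
     else y (Some (true, k))) (l.+1 * 2).
  apply: slp_map => k _ /=; case: (sub k); last first.
    exact: slp_weaken (slp_var F (fun=> _) 1).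
  apply: slp_sub (slp_var F (fun=> _) 1) _.
  exact: slp_mul (slp_var F (fun=> _) 1) (slp_var F (fun=> _) 1).
have [W [sz [outs [t0 [ht0 houts hW]]]]] := sP s.+1 ins isT hins.
pose e' := Equation (lo e).+1 (hi e) (fun k => outs (k - lo e)%N) (outs 0%N).
have ss' : (s <= s.+1 + sz)%N by lia.
have [p hp] := IH e' (s.+1 + sz)%N piv (ltac:(rewrite /=; lia)) (leq_trans s0s ss')
  (conj (fun k => houts _) (houts 0%N)) hie lthi (ltac:(rewrite /=; lia))
  (pivots_ok_leq ss' (leqnn _) ok).
exists (Arith Div (reg e (lo e)) (reg q (lo e)) (W p)) => mem hm nz nz0 [x0 [he0 hs0]].
have q0 : mem`_(reg q (lo e)) != 0 by exact: nz.
set f := mem`_(reg e (lo e)) / mem`_(reg q (lo e)).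
have [ext [k1 k2 k3]] := hW (rcons mem f) (ltac:(by rewrite size_rcons hm)).
pose ex := f :: ext.
have memE : rcons mem f ++ ext = mem ++ ex by rewrite cat_rcons.
rewrite memE in k2 k3.
have okm : pivots_ok (size mem) (hi e) piv by rewrite hm.
have wfm j : regs_below (size mem) (rows j) by rewrite hm.
have rd k : (k < s)%N -> (rcons mem f)`_k = mem`_k.
  by move=> ks; rewrite nth_rcons hm ks.
have rdf : (rcons mem f)`_s = f by rewrite nth_rcons hm ltnn eqxx.
have e'E x : holds mem q x -> holds (mem ++ ex) e' x <-> holds mem e x.
  rewrite /holds /= => hq.
  have lo1 : (mem ++ ex)`_(outs 0%N) = mem`_(rhs e) - f * mem`_(rhs q).
    by rewrite k3 // /sub addn0 khi /ins rdf !rd.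
  have regE k : (lo e < k < hi e)%N -> (mem ++ ex)`_(outs (k - lo e)%N) =
      mem`_(reg e k) - (if (k < hi q)%N then f * mem`_(reg q k) else 0).
    move=> /andP[ek kh]; have [j kE] : exists j, k = (lo e + j.+1)%N.
      by exists (k - lo e - 1)%N; lia.
    rewrite kE addKn k3; last by lia.
    by rewrite /sub; case: ifP => _; rewrite /ins ?rdf !rd ?subr0; rewrite ?wfe1 ?wfq1.
  have fq : f * mem`_(reg q (lo e)) = mem`_(reg e (lo e)) by rewrite divfK.
  suff -> : \sum_((lo e).+1 <= c0 < hi e) (mem ++ ex)`_(outs (c0 - lo e)%N) * x c0 =
      \sum_(lo e <= c0 < hi e) mem`_(reg e c0) * x c0 - f * mem`_(rhs q).
    by rewrite lo1; split=> [/addIr|->].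
  rewrite -hq loq [\sum_(lo e <= c0 < hi q) _]big_ltn //.
  rewrite [\sum_(lo e <= c0 < hi e) _]big_ltn // mulrDr mulrA fq opprD addrACA subrr add0r.
  rewrite mulr_sumr [X in _ = _ - X](big_nat_widen _ _ (hi e)) //= [X in _ = _ - X]big_mkcond /=.
  rewrite -sumrB; apply: eq_big_nat => k hk; rewrite regE // mulrBl.
  by case: ifP; rewrite ?mul0r // mulrA.
have sE x : pending_system rows m (mem ++ ex) piv i.+1 x <-> pending_system rows m mem piv i.+1 x.
  exact: pending_system_cat okm wfm.
have hm' : size (mem ++ ex) = (s.+1 + sz)%N.
  by rewrite size_cat hm /= k1 addnS addSn.
have hqx x : pending_system rows m mem piv i.+1 x -> holds mem q x by case=> h _; exact: h pivk.
have [|x [t [h1 h2 h3 /sE h4]]] := hp _ hm' (pivots_nz_cat _ okm nz).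
  by exists x0; split; [apply/e'E => //; exact: hqx|exact/sE].
exists x, (t0 + t).+1; split=> //.
- by rewrite /= (negPf q0) -/f k2 h1.
- by nia.
- by apply/e'E => //; exact: hqx.
Qed.

Lemma eliminate k i s piv H : (k + i = m)%N -> (s0 <= s)%N ->
  (H <= n)%N -> (forall j, (i <= j)%N -> (H <= hi (rows j))%N) -> pivots_ok s H piv ->
  eliminable s piv i (k * (w * (2 * w + 2)) + n * (2 * w + 2)).
Proof.
elim: k i s piv H => [|k IH] i s piv H kim s0s Hn Hr ok.
  have [] := @back_substitution n piv n s (fun=> 0%N) (leqnn n).
  - exact: leq_trans s0s.
  - by move=> _; exact: leq_trans s0s.
  - exact: pivots_ok_leq ok.
  move=> p hp; exists p => mem hm nz _; have [x [t [h1 h2 h3 h4]]] := hp mem hm nz.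
  exists x, t; split=> //; split=> [c q hq|j]; last by lia.
  by apply: (h4 _ _ _ hq); have [_ h5 h6 _ _] := ok _ _ hq; lia.
have im : (i < m)%N by lia.
have outer s' piv' : (s0 <= s')%N -> pivots_ok s' (hi (rows i)) piv' ->
    eliminable s' piv' i.+1 (k * (w * (2 * w + 2)) + n * (2 * w + 2)).
  move=> s0s' ok'; apply: (IH _ _ _ _ _ s0s' (hi_rows_n i) _ ok'); first by lia.
  by move=> j ij; apply: hi_rows_mono; exact: ltnW.
have [p hp] := insert_row im outer erefl s0s (regs_below_leq s0s (wf_rows i)) erefl
  (lo_hi_rows im) (hi_rows_w i) (pivots_ok_leq (leqnn s) (Hr i (leqnn i)) ok).
have sysE mem x : pending_system rows m mem piv i x <->
    holds mem (rows i) x /\ pending_system rows m mem piv i.+1 x.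
  split=> [[h1 h2]|[h1 [h2 h3]]].
    by split; [apply: h2; lia|split=> // j ij; apply: h2; lia].
  split=> // j; case: (ltngtP i j) => [ij|//|<-] //= jm; apply: h3; lia.
exists p => mem hm nz [x0 /sysE hx0].
have [x [t [h1 h2 h3 h4]]] := hp mem hm nz (ex_intro _ x0 hx0).
exists x, t; split=> //; last exact/sysE.
have := hi_rows_w i; move: h2; nia.
Qed.

End BandElimination.

(** * Banded systems as register files *)

Section Entries.
Variable F : fieldType.

Definition vec_fun n (x : 'cV[F]_n) (j : nat) : F :=
  if insub j is Some i then x i ord0 else 0.

Lemma vec_funE n (x : 'cV[F]_n) (i : 'I_n) : vec_fun x i = x i ord0.
Proof. by rewrite /vec_fun valK. Qed.

Lemma vec_entriesE n (x : 'cV[F]_n) : vec_entries x = mkseq (vec_fun x) n.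
Proof.
rewrite /vec_entries /mkseq -val_enum_ord -map_comp.
by apply/eq_map => i /=; rewrite vec_funE.
Qed.

Lemma vec_entries_fun n (x : nat -> F) :
  vec_entries (\col_(i < n) x i) = mkseq x n.
Proof.
rewrite /vec_entries /mkseq -val_enum_ord -map_comp.
by apply/eq_map => i /=; rewrite mxE.
Qed.

Lemma flatten_mkseq (T : Type) (f : nat -> nat -> T) m n : (0 < n)%N ->
  flatten [seq mkseq (f i) n | i <- iota 0 m] =
  mkseq (fun k => f (k %/ n)%N (k %% n)%N) (m * n).
Proof.
move=> n0; elim: m => [|m IH] //.
rewrite -addn1 iotaD map_cat flatten_cat IH /= cats0 add0n mulnDl mul1n.
rewrite /mkseq iotaD map_cat add0n; congr (_ ++ _).
rewrite -[(m * n)%N]addn0 iotaDl -map_comp; apply/eq_in_map => k.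
rewrite mem_iota add0n => /andP[_ kn] /=.
by rewrite divnMDl // modnMDl divn_small // modn_small // addn0.
Qed.

Lemma mx_entries_fun n (f : nat -> nat -> F) : (0 < n)%N ->
  mx_entries (\matrix_(i < n, j < n) f i j) =
  mkseq (fun k => f (k %/ n)%N (k %% n)%N) (n * n).
Proof.
move=> n0; rewrite -flatten_mkseq // /mx_entries -val_enum_ord -map_comp.
congr flatten; apply/eq_map => i /=; rewrite /mkseq -val_enum_ord -map_comp.
by apply/eq_map => j /=; rewrite mxE.
Qed.

Definition mx_fun n (M : 'M[F]_n) (i j : nat) : F :=
  if insub j is Some j' then vec_fun (col j' M) i else 0.

Lemma mx_funE n (M : 'M[F]_n) (i j : 'I_n) : mx_fun M i j = M i j.
Proof. by rewrite /mx_fun valK vec_funE mxE. Qed.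

Lemma mx_entriesE n (M : 'M[F]_n) : (0 < n)%N ->
  mx_entries M = mkseq (fun k => mx_fun M (k %/ n) (k %% n)) (n * n).
Proof.
move=> n0; rewrite -mx_entries_fun //; congr mx_entries.
by apply/matrixP => i j; rewrite mxE mx_funE.
Qed.

End Entries.

Section BandSolver.
Variable F : fieldType.

(** Singular matrices are solved at the same cost: dependent rows reduce to
equations with empty window, and free unknowns are set to zero. *)
Lemma band_solver n b : (0 < n)%N ->
  exists p : prog F, forall (M : 'M[F]_n) (y : 'cV[F]_n),
    (forall i j : 'I_n, (i + b < j)%N || (j + b < i)%N -> M i j = 0) ->
    (exists x, M *m x = y) ->
    exists x t, [/\ run p (mx_entries M ++ vec_entries y) = Some (vec_entries x, t),
      M *m x = y & (t <= 4 * n * (2 * b + 2) ^ 2)%N].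
Proof.
move=> n0; pose w := (2 * b + 1)%N.
pose rows i := Equation (i - b) (minn (i + b + 1) n)
  (fun c => if (i < n)%N && (c < n)%N then (i * n + c)%N else 0%N)
  (if (i < n)%N then (n * n + i)%N else 0%N).
have s0 : (0 < n * n + n)%N by rewrite ltn_addl.
have wfr j : regs_below (n * n + n) (rows j).
  split=> [c|] /=; last by case: ifP => // jn; rewrite ltn_add2l.
  by case: ifP => // /andP[jn cn]; nia.
have [p hp] : eliminable F n n rows (n * n + n) (fun=> None) 0
    (n * (w * (2 * w + 2)) + n * (2 * w + 2)).
  apply: (@eliminate F w n n (n * n + n)%N rows s0 wfr _ _ _ _ n 0%N
   (n * n + n)%N (fun=> None) 0%N (addn0 n) (leqnn _) (leq0n n) (fun _ _ => leq0n _)).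
  - by move=> j; exact: geq_minr.
  - by move=> j /=; rewrite /w; lia.
  - by move=> j /= jn; lia.
  - by move=> i j /= ij; lia.
  - by move=> c q.
exists p => M y hM [x0 hx0].
set mem := mx_entries M ++ vec_entries y.
have smx : size (mx_entries M) = (n * n)%N by rewrite mx_entriesE // size_mkseq.
have sm : size mem = (n * n + n)%N by rewrite size_cat smx vec_entriesE size_mkseq.
have rowE (i : 'I_n) (x : 'cV[F]_n) (f : nat -> F) : (forall j : 'I_n, f j = x j ord0) ->
    holds mem (rows i) f <-> (M *m x) i ord0 = y i ord0.
  move=> fx; rewrite /holds /= ltn_ord /mem.
  rewrite nth_cat smx ltnNge leq_addr /= addKn vec_entriesE nth_mkseq // vec_funE.
  suff -> : (M *m x) i ord0 = \sum_(i - b <= c < minn (i + b + 1) n)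
      (mx_entries M ++ mkseq (vec_fun y) n)`_(if (c < n)%N then (i * n + c)%N else 0%N) * f c by [].
  have -> : (minn (i + b + 1) n = n - (n - (i + b + 1)))%N by lia.
  rewrite mxE (bigID (fun c : 'I_n => (i - b <= c < minn (i + b + 1) n)%N)) /= addrC.
  rewrite big1 ?add0r => [|c hc]; last by rewrite hM ?mul0r //; have := ltn_ord c; lia.
  rewrite big_geq_mkord.
  rewrite [RHS](big_ord_widen_cond n (fun c => (i - b <= c)%N) (fun c =>
    (mx_entries M ++ mkseq (vec_fun y) n)`_(if (c < n)%N then (i * n + c)%N else 0%N)
      * f c)); last by lia.
  apply: eq_big => [c|c _]; first by have := ltn_ord c; lia.
  have lt : (i * n + c < n * n)%N by have := ltn_ord c; have := ltn_ord i; nia.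
  rewrite ltn_ord nth_cat smx lt fx mx_entriesE // nth_mkseq //.
  by rewrite divnMDl // modnMDl divn_small // modn_small // addn0 mx_funE.
have [||x [t [h1 h2 [_ h3]]]] := hp mem sm.
- by [].
- exists (vec_fun x0); split=> // j /andP[_ jn].
  by apply/(rowE (Ordinal jn) x0); [move=> k; rewrite vec_funE|rewrite hx0].
exists (\col_j x j), t; split.
- by rewrite vec_entries_fun.
- apply/colP => i; apply/(rowE i _ x); last by apply: h3; rewrite ltn_ord.
  by move=> j; rewrite mxE.
- by move: h2; rewrite /w; nia.
Qed.

End BandSolver.

(** * Chebyshev polynomials on the Clenshaw-Curtis grid *)

Section ChebPoly.
Variable F : fieldType.

Lemma chebTSS n : chebT F n.+2 = 'X * chebT F n.+1 *+ 2 - chebT F n.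
Proof. by []. Qed.

Lemma nat_ind2 (P : nat -> Prop) :
  P 0%N -> P 1%N -> (forall n, P n -> P n.+1 -> P n.+2) -> forall n, P n.
Proof.
move=> h0 h1 h n; suff : P n /\ P n.+1 by case.
by elim: n => // n [h2 h3]; split=> //; exact: h.
Qed.

Lemma chebT_deriv n :
  (1 - 'X^2) * (chebT F n)^`() = ('X * chebT F n - chebT F n.+1) *+ n.
Proof.
elim/nat_ind2: n => [||n IH IH1].
- by rewrite derivC mulr0 mulr0n.
- rewrite chebTSS /= derivX; ring.
rewrite (chebTSS n) derivB derivMn derivM derivX mulrBr mulrnAr mulrDr mul1r.
rewrite [_ * ('X * _)]mulrCA IH1 IH (chebTSS n.+1) (chebTSS n).
ring.
Qed.

End ChebPoly.

Section Trig.
Variable R : realType.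

Lemma chebT_cos n (t : R) : (chebT R[i] n).[(cos t)%:C] = (cos (n%:R * t))%:C.
Proof.
elim/nat_ind2: n => [||n IH IH1].
- by rewrite hornerC mul0r cos0.
- by rewrite hornerX mul1r.
rewrite chebTSS hornerD hornerN hornerMn hornerM hornerX IH IH1.
rewrite -rmorphM -rmorphMn -rmorphB; congr (_%:C).
have -> : n.+2%:R * t = n.+1%:R * t + t by rewrite -[n.+2]addn1 natrD mulrDl mul1r.
have -> : n%:R * t = n.+1%:R * t - t by rewrite -[n.+1]addn1 natrD mulrDl mul1r addrK.
by rewrite cosB cosD; ring.
Qed.

(** The DCT-I weights are those of the trapezoidal rule. *)
Lemma trap_sum nu (f : nat -> R) : \sum_(k < nu.+2) trap_weight R nu.+1 k * f k =
  2^-1 * \sum_(k < nu.+1) (f k + f k.+1).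
Proof.
rewrite sum_ends /= /trap_weight ltnn /= ltnn.
rewrite (eq_bigr (fun k : 'I_nu.+2 => f k)) => [|k ->]; last by rewrite mul1r.
have h := sum_ends (fun k : 'I_nu.+2 => f k).
have h1 : \sum_(k < nu.+2) f k = \sum_(k < nu.+1) f k + f nu.+1 by rewrite big_ord_recr.
have h2 : \sum_(k < nu.+2) f k = f 0%N + \sum_(k < nu.+1) f k.+1 by rewrite big_ord_recl.
rewrite big_split /=; move: h h1 h2 => /=; lra.
Qed.

(** Multiplying by [sin h] makes the sum telescope:
[sin h (cos (a - h) + cos (a + h)) = cos h (sin (a + h) - sin (a - h))]. *)
Lemma trapezoid_cos n (h : R) :
  sin h * \sum_(k < n) (cos (k%:R * (2 * h)) + cos (k.+1%:R * (2 * h))) =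
  cos h * sin (n%:R * (2 * h)).
Proof.
elim: n => [|n IH]; first by rewrite big_ord0 mul0r sin0 !mulr0.
rewrite big_ord_recr /= mulrDr IH -[n.+1]addn1 natrD.
have -> : n%:R * (2 * h) = (n%:R * 2 + 1) * h - h by ring.
have -> : (n%:R + 1%:R) * (2 * h) = (n%:R * 2 + 1) * h + h by ring.
by rewrite cosB sinB cosD sinD; ring.
Qed.

Lemma trap_cos nu s : (s <= 2 * nu.+1)%N ->
  \sum_(k < nu.+2) trap_weight R nu.+1 k * cos ((s * k)%:R * pi / nu.+1%:R) =
  if (0 < s < 2 * nu.+1)%N then 0 else nu.+1%:R.
Proof.
move=> hs; have N0 : nu.+1%:R != 0 :> R by rewrite pnatr_eq0.
(* half of the angle s pi / (nu + 1) *)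
pose h : R := s%:R * pi / (2 * nu.+1%:R).
have hE k : (s * k)%:R * pi / nu.+1%:R = k%:R * (2 * h).
  by rewrite /h natrM; field.
under eq_bigr do rewrite hE.
rewrite (trap_sum _ (fun k => cos (k%:R * (2 * h)))).
have hN : nu.+1%:R * (2 * h) = s%:R * pi by rewrite /h; field.
case: ifP => [/andP[s0 s1]|/negbT ns].
  have := trapezoid_cos nu.+1 h; rewrite hN sin_natpi mulr0 => /eqP.
  rewrite mulf_eq0 => /orP[/eqP sh|/eqP ->]; last by rewrite mulr0.
  have : 0 < sin h.
    apply: sin_gt0_pi; rewrite /h; apply/andP; split.
      by rewrite divr_gt0 ?mulr_gt0 ?pi_gt0 ?ltr0n.
    rewrite ltr_pdivrMr ?mulr_gt0 ?ltr0n // mulrC ltr_pM2l ?pi_gt0 //.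
    by rewrite -natrM ltr_nat.
  by rewrite sh ltxx.
have hk k : cos (k%:R * (2 * h)) = 1.
  rewrite /h; have [->|->] : s = 0%N \/ s = (2 * nu.+1)%N by lia.
    by rewrite !mul0r !mulr0 cos0.
  have -> : k%:R * (2 * ((2 * nu.+1)%:R * pi / (2 * nu.+1%:R))) = (2 * k)%:R * pi :> R.
    by rewrite !natrM; field.
  by rewrite cos_natpi exprM sqrrN !expr1n.
rewrite (eq_bigr (fun=> 2)) => [|k _]; last by rewrite !hk.
by rewrite sumr_const card_ord -[2 *+ _]mulr_natr mulKf // pnatr_eq0.
Qed.

End Trig.

(** * The Levin operator in the cosine basis *)

Section BandedMatrices.
Variable F : fieldType.

Definition bandwidth n (b : nat) (M : 'M[F]_n) : Prop :=
  forall i j : 'I_n, (i + b < j)%N || (j + b < i)%N -> M i j = 0.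

Lemma bandwidth_leq n b b' (M : 'M[F]_n) : (b <= b')%N -> bandwidth b M -> bandwidth b' M.
Proof. by move=> bb h i j ij; apply: h; lia. Qed.

Lemma bandwidth_add n b (M M' : 'M[F]_n) : bandwidth b M -> bandwidth b M' -> bandwidth b (M + M').
Proof. by move=> h h' i j ij; rewrite mxE h // h' // addr0. Qed.

Lemma bandwidth_scale n b a (M : 'M[F]_n) : bandwidth b M -> bandwidth b (a *: M).
Proof. by move=> h i j ij; rewrite mxE h // mulr0. Qed.

Lemma bandwidth_scalar n a : bandwidth 0 (a%:M : 'M[F]_n).
Proof.
by move=> i j ij; rewrite mxE; case: eqP ij => // ->; rewrite addn0 ltnn.
Qed.

Lemma bandwidth_mul n b b' (M M' : 'M[F]_n) :
  bandwidth b M -> bandwidth b' M' -> bandwidth (b + b') (M *m M').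
Proof.
move=> h h' i j ij; rewrite mxE big1 // => k _.
have [ik|ik] := boolP ((i + b < k)%N || (k + b < i)%N).
  by rewrite h ?mul0r.
by rewrite h' ?mulr0 //; lia.
Qed.

Lemma bandwidth_horner n (M : 'M[F]_n.+1) (p : {poly F}) :
  bandwidth 1 M -> bandwidth (size p).-1 (horner_mx M p).
Proof.
move=> hM; elim/poly_ind: p => [|p c IH].
  by rewrite raddf0 => i j _; rewrite mxE.
rewrite rmorphD rmorphM /= horner_mx_X horner_mx_C size_MXaddC.
case: eqP IH => [-> _|/eqP p0 IH] /=.
  rewrite raddf0 mul0r add0r.
  exact: bandwidth_leq (bandwidth_scalar _).
apply: bandwidth_add; last exact: bandwidth_leq (bandwidth_scalar _).
by have := bandwidth_mul IH hM; rewrite addn1 prednK ?size_poly_gt0.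
Qed.

(** Transposed, this is the freeness of the rows of a square matrix. *)
Lemma inj_unitmx n (M : 'M[F]_n) :
  (forall x : 'cV_n, M *m x = 0 -> x = 0) -> M \in unitmx.
Proof.
move=> h; rewrite -unitmx_tr -row_free_unit; apply: inj_row_free => v hv.
by apply: trmx_inj; rewrite trmx0; apply: h; rewrite -[M]trmxK -trmx_mul hv trmx0.
Qed.

Lemma sum_delta n (a : nat -> F) j :
  \sum_(k < n) a k * ((k : nat) == j)%:R = if (j < n)%N then a j else 0.
Proof.
case: ltnP => jn; last first.
  by rewrite big1 // => k _; rewrite (ltn_eqF (leq_trans (ltn_ord k) jn)) mulr0.
rewrite (bigD1 (Ordinal jn)) //= eqxx mulr1 big1 ?addr0 // => k.
by rewrite -val_eqE /= => /negPf ->; rewrite mulr0.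
Qed.

End BandedMatrices.

Section Levin.
Variable R : realType.
Variable nu : nat.
Local Notation C := R[i].
Local Notation N := nu.+1.

Definition grid_cos (k : nat) : C := (cos (k%:R * pi / N%:R))%:C.

Lemma grid_cos0 : grid_cos 0 = 1. Proof. by rewrite /grid_cos !mul0r cos0. Qed.

Lemma grid_cosN m : grid_cos (m * N) = (-1) ^+ m.
Proof.
rewrite /grid_cos natrM mulrAC mulfK ?pnatr_eq0 // cos_natpi.
by rewrite rmorphXn /= rmorphN1.
Qed.

Lemma cc_point_cos m : (cc_point R nu m)%:C = grid_cos m. Proof. by []. Qed.

Lemma chebT_grid n m : (chebT C n).[grid_cos m] = grid_cos (m * n).
Proof.
rewrite /grid_cos chebT_cos; congr ((cos _)%:C).
by rewrite natrM; ring.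
Qed.

Lemma grid_cos_rec m k :
  grid_cos (m * k.+2) = grid_cos m * grid_cos (m * k.+1) *+ 2 - grid_cos (m * k).
Proof.
by rewrite -!chebT_grid chebTSS hornerD hornerN hornerMn hornerM hornerX.
Qed.

Definition inner (k : nat) : bool := (0 < k < N)%N.

(** Maps cosine coefficients to grid values. *)
Definition values_mx : 'M[C]_nu.+2 := \matrix_(m, k) grid_cos (m * k).

(** The halving of the end components that distinguishes the DCT-I from a plain
cosine sum. *)
Definition trap_mx : 'M[C]_nu.+2 := diag_mx (\row_k (trap_weight R N k)%:C).

Lemma cos_orthogonal m n : (m <= N)%N -> (n <= N)%N ->
  (\sum_(k < nu.+2) trap_weight R N k *
     (cos ((m * k)%:R * pi / N%:R) * cos ((n * k)%:R * pi / N%:R))) * trap_weight R N n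
  = N%:R / 2 * (m == n)%:R :> R.
Proof.
move=> mN nN; pose d := ((m - n) + (n - m))%N.
have prod k : cos ((m * k)%:R * pi / N%:R) * cos ((n * k)%:R * pi / N%:R) =
    2^-1 * cos (((m + n) * k)%:R * pi / N%:R) + 2^-1 * cos ((d * k)%:R * pi / N%:R) :> R.
  have -> : cos ((d * k)%:R * pi / N%:R) =
      cos ((m * k)%:R * pi / N%:R - (n * k)%:R * pi / N%:R) :> R.
    rewrite -!mulrBl; case: (leqP n m) => mn.
      by rewrite /d (eqP mn) addn0 mulnBl natrB ?leq_mul2r ?mn ?orbT.
    rewrite /d (eqP (ltnW mn)) add0n mulnBl -[in RHS]cosN -!mulNr opprB natrB //.
    by rewrite leq_mul2r ltnW ?orbT.
  rewrite mulnDl natrD !mulrDl cosB cosD; lra.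
under eq_bigr do rewrite prod mulrDr !(mulrCA (trap_weight _ _ _)).
rewrite big_split /= -!mulr_sumr !trap_cos; [|lia|lia].
case: eqP => [mn|mn]; last first.
  rewrite !ifT; [by rewrite !mulr0 addr0 mul0r|by rewrite /d; lia|].
  by lia.
rewrite /d mn subnn addn0 /= mulr1 /trap_weight.
have -> : (0 < n + n < 2 * N)%N = (0 < n < N)%N by lia.
by case: ifP => _; field.
Qed.

(** The discrete orthogonality of cosines, in a form that exhibits the square of
the DCT-I matrix as a scalar. *)
Lemma values_mx_inv : values_mx *m trap_mx *m values_mx *m trap_mx = (N%:R / 2)%:M.
Proof.
apply/matrixP => m n; rewrite mul_mx_diag !mxE.
rewrite (eq_bigr (fun k : 'I_nu.+2 => (trap_weight R N k *
   (cos ((m * k)%:R * pi / N%:R) * cos ((n * k)%:R * pi / N%:R)))%:C)); last first.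
  by move=> k _; rewrite mul_mx_diag !mxE /grid_cos (mulnC k n) !rmorphM; ring.
have mN : (m <= N)%N by rewrite -ltnS.
have nN : (n <= N)%N by rewrite -ltnS.
have := congr1 (real_complex R) (cos_orthogonal mN nN).
rewrite rmorphM rmorph_sum /= => ->.
rewrite (rmorphM (real_complex R)) (fmorph_div (real_complex R)).
by rewrite !(rmorph_nat (real_complex R)) mulr_natr.
Qed.

Lemma N2_neq0 : (N%:R / 2 : C) != 0.
Proof. by rewrite mulf_neq0 ?invr_eq0 ?pnatr_eq0. Qed.

Lemma values_mx_unit : values_mx \in unitmx.
Proof.
suff : (N%:R / 2)^-1 *: (values_mx *m trap_mx *m values_mx *m trap_mx) = 1%:M.
  by rewrite -!mulmxA scalemxAr => /mulmx1_unit[].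
by rewrite values_mx_inv scale_scalar_mx mulVf ?N2_neq0.
Qed.

Lemma dct1_mx (x : 'cV[C]_nu.+2) : dct1 x = values_mx *m (trap_mx *m x).
Proof.
apply/colP => m; rewrite dct1E mxE; apply: eq_bigr => k _.
by rewrite mul_diag_mx !mxE /grid_cos; ring.
Qed.

(** The inverse of [values_mx], in the form in which an algorithm computes it. *)
Definition dct_coords (v : 'cV[C]_nu.+2) : 'cV[C]_nu.+2 :=
  (N%:R / 2)^-1 *: (trap_mx *m dct1 v).

Lemma dct_coordsK v : values_mx *m dct_coords v = v.
Proof.
have h : values_mx *m trap_mx *m (values_mx *m trap_mx) = (N%:R / 2)%:M.
  by rewrite mulmxA values_mx_inv.
rewrite /dct_coords dct1_mx -scalemxAr !mulmxA -(mulmxA _ values_mx) h mul_scalar_mx.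
by rewrite scalerA mulVf ?N2_neq0 // scale1r.
Qed.

Lemma values_mx_first (r : 'cV[C]_nu.+2) : (values_mx *m r) ord0 ord0 = \sum_k r k ord0.
Proof. by rewrite mxE; apply: eq_bigr => k _; rewrite mxE mul0n grid_cos0 mul1r. Qed.

Lemma values_mx_last (r : 'cV[C]_nu.+2) :
  (values_mx *m r) ord_max ord0 = \sum_(k < nu.+2) (-1) ^+ k * r k ord0.
Proof. by rewrite mxE; apply: eq_bigr => k _; rewrite mxE mulnC grid_cosN. Qed.

(** Only the coefficients [r_0] and [r_N] can be nonzero.  The value at [x = 1] is
[r_0 + r_N], and the value at [x = -1] is [r_0 - r_N] because [N = nu + 1] is odd. *)
Lemma ends_zero (r : 'cV[C]_nu.+2) : ~~ odd nu ->
  (forall k : 'I_nu.+2, inner k -> r k ord0 = 0) -> zero_ends (values_mx *m r) -> r = 0.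
Proof.
move=> nu_even rin [h0 hN]; move: h0 hN; rewrite values_mx_first values_mx_last !sum_ends /=.
rewrite !big1 => [||k /rin -> //]; last by move=> k /rin ->; rewrite mulr0.
rewrite !addr0 expr0 mul1r exprS mulN1r -signr_odd (negPf nu_even) expr0 mulN1r.
move=> h0 /eqP; rewrite subr_eq0 => /eqP h1.
have hN : r ord_max ord0 = 0.
  apply/eqP; move: h0 => /eqP; rewrite h1 -mulr2n -mulr_natr mulf_eq0 pnatr_eq0 orbF //.
apply/colP => k; rewrite [RHS]mxE.
have [/rin //|nk] := boolP (inner k).
have [->|->] : k = ord0 \/ k = ord_max.
  have := ltn_ord k; have := nk; rewrite /inner => {}nk kN.
  have [k0|kN'] : val k = 0%N \/ val k = N by rewrite /=; lia.
    by left; apply: val_inj.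
  by right; apply: val_inj.
- by rewrite h1.
- by [].
Qed.

Lemma zero_endsP (x : 'cV[C]_nu.+2) :
  zero_ends x <-> forall k : 'I_nu.+2, ~~ inner k -> x k ord0 = 0.
Proof.
split=> [[h0 hN] k|h]; last by split; apply: h; rewrite /inner /= ?ltnn ?andbF.
rewrite /inner => nk; have kN := ltn_ord k.
have [k0|kN'] : val k = 0%N \/ val k = N by rewrite /=; lia.
  by have -> : k = ord0 by apply: val_inj.
by have -> : k = ord_max by apply: val_inj.
Qed.

(** Multiplication by [x] on cosine coefficients: [x T_l] is the mean of [T_(l-1)]
and [T_(l+1)].  The two end columns have a single entry: [x T_0 = T_1], and on the
grid [T_(N+1)] coincides with [T_(N-1)]. *)
Definition mulX_mx : 'M[C]_nu.+2 := \matrix_(k, l)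
  ((if inner l then 2^-1 else 1) * ((k.+1 == l)%:R + (k == l.+1 :> nat)%:R)).

(** The operator [(1 - x^2) d/dx] on cosine coefficients, from
[(1 - x^2) T_l' = l/2 (T_(l-1) - T_(l+1))].  Its last column misses the aliased
term; it is only ever applied to vectors that vanish there. *)
Definition deriv_mx : 'M[C]_nu.+2 := \matrix_(k, l)
  (l%:R / 2 * ((k.+1 == l)%:R - (k == l.+1 :> nat)%:R)).

Lemma grid_cosNB m : grid_cos (m * nu) = grid_cos m * grid_cos (m * N).
Proof.
rewrite grid_cosN /grid_cos; have -> : (m * nu)%:R * pi / N%:R = m%:R * pi - m%:R * pi / N%:R :> R.
  have N0 : N%:R != 0 :> R by rewrite pnatr_eq0.
  have nuE : nu%:R = N%:R - 1 :> R by rewrite -natr1 addrK.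
  by rewrite natrM nuE; move: (N%:R) N0 => u u0; field.
rewrite cosB cos_natpi sin_natpi mul0r addr0 rmorphM /= rmorphXn /= rmorphN1.
by rewrite mulrC.
Qed.

Lemma values_mx_mulX (m l : 'I_nu.+2) : (values_mx *m mulX_mx) m l = grid_cos m * grid_cos (m * l).
Proof.
rewrite mxE (eq_bigr (fun k : 'I_nu.+2 => (if inner l then 2^-1 else 1) *
   (grid_cos (m * k) * (k.+1 == l)%:R + grid_cos (m * k) * (k == l.+1 :> nat)%:R))); last first.
  by move=> k _; rewrite !mxE; ring.
rewrite -mulr_sumr big_split /= (sum_delta _ (fun k => grid_cos (m * k))).
case: l => -[|l] lN /=.
  by rewrite mul1r big1 ?add0r ?muln1 ?muln0 ?grid_cos0 ?mulr1 // => k _; rewrite mulr0.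
under eq_bigr do rewrite eqSS.
rewrite (sum_delta _ (fun k => grid_cos (m * k))) ltnW //.
have -> : inner l.+1 = (l < nu)%N by [].
have -> : (l.+2 < nu.+2)%N = (l < nu)%N by [].
case: ltnP => lN'; last first.
  have -> : l = nu by apply/eqP; rewrite eqn_leq lN' andbT -ltnS.
  by rewrite addr0 mul1r grid_cosNB.
by rewrite grid_cos_rec; field.
Qed.

Lemma values_mx_deriv (m n : 'I_nu.+2) : inner n ->
  (values_mx *m deriv_mx) m n = (1 - grid_cos m ^+ 2) * (chebT C n)^`().[grid_cos m].
Proof.
move=> nin; have := congr1 (fun p => p.[grid_cos m]) (chebT_deriv C n).
rewrite hornerM hornerD hornerN hornerC hornerXn => ->.
rewrite hornerMn hornerD hornerN hornerM hornerX !chebT_grid.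
rewrite mxE (eq_bigr (fun k : 'I_nu.+2 => n%:R / 2 *
   (grid_cos (m * k) * (k.+1 == n)%:R - grid_cos (m * k) * (k == n.+1 :> nat)%:R))); last first.
  by move=> k _; rewrite !mxE; ring.
rewrite -mulr_sumr sumrB /= (sum_delta _ (fun k => grid_cos (m * k))).
case: n nin => -[|n] nN // nin /=.
under eq_bigr do rewrite eqSS.
rewrite (sum_delta _ (fun k => grid_cos (m * k))) ltnW //.
have -> : (n.+2 < nu.+2)%N by [].
by rewrite grid_cos_rec -mulr_natr; field.
Qed.

(** [values_mx] intertwines [mulX_mx] with the pointwise multiplication by the
grid points, hence also polynomials in them. *)
Lemma values_mx_horner (p : {poly C}) (m n : 'I_nu.+2) :
  (values_mx *m horner_mx mulX_mx p) m n = p.[grid_cos m] * grid_cos (m * n).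
Proof.
elim/poly_ind: p n => [|p c IH] n.
  by rewrite raddf0 mulmx0 mxE horner0 mul0r.
rewrite rmorphD rmorphM /= horner_mx_X horner_mx_C hornerMXaddC.
rewrite mulmxDr mulmxA mxE [X in X + _]mxE mul_mx_scalar [X in _ + X]mxE.
rewrite (eq_bigr (fun k : 'I_nu.+2 => p.[grid_cos m] * (values_mx m k * mulX_mx k n))); last first.
  by move=> k _; rewrite IH [values_mx m k]mxE mulrA.
have := values_mx_mulX m n; rewrite mxE => h.
by rewrite -mulr_sumr h mxE; ring.
Qed.

(** The coefficients [a] and [b] cover the Levin operator itself, [a = 1] and
[b = i omega], its multiple with [a = (i omega)^-1] and [b = 1], and the limit
[a = 0] and [b = 1] for large [omega]. *)
Definition levin_mx (a b : C) (g : {poly C}) : 'M[C]_nu.+2 :=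
  a *: deriv_mx + b *: horner_mx mulX_mx ((1 - 'X^2) * g^`()).

Lemma values_mx_levin a b g (m n : 'I_nu.+2) : inner n ->
  (values_mx *m levin_mx a b g) m n = (1 - grid_cos m ^+ 2) *
     (a * (chebT C n)^`().[grid_cos m] + b * (g^`().[grid_cos m] * grid_cos (m * n))).
Proof.
move=> nin; rewrite mulmxDr -!scalemxAr mxE [X in X + _]mxE [X in _ + X]mxE.
rewrite values_mx_deriv // values_mx_horner hornerM hornerD hornerN hornerC hornerXn.
ring.
Qed.

Lemma A_tildeE g omega (m n : 'I_nu.+2) : inner n ->
  A_tilde nu g omega m n = (values_mx *m levin_mx 1 ('i * omega%:C) g) m n.
Proof.
move=> nin; rewrite values_mx_levin // mxE /levin_op_tilde /levin_op cc_point_cos.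
rewrite hornerM hornerD hornerN hornerC hornerXn.
by rewrite hornerD hornerZ hornerM chebT_grid mul1r.
Qed.

Lemma mulmx_zero_ends (A : 'M[C]_nu.+2) x : zero_ends x ->
  forall m, (A *m x) m ord0 = \sum_(n < nu.+2 | inner n) A m n * x n ord0.
Proof.
move=> /zero_endsP hx m; rewrite mxE (bigID (fun n : 'I_nu.+2 => inner n)) /= addrC.
by rewrite big1 ?add0r // => n /hx ->; rewrite mulr0.
Qed.

(** The weight [1 - x^2] vanishes at the two end points. *)
Lemma values_levin_ends a b g x : zero_ends x -> zero_ends (values_mx *m (levin_mx a b g *m x)).
Proof.
move=> hx; rewrite mulmxA; split; rewrite mulmx_zero_ends // big1 // => n nin.
  by rewrite values_mx_levin // grid_cos0 expr1n subrr !mul0r.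
by rewrite values_mx_levin // -[X in grid_cos X]mul1n grid_cosN sqrrN !expr1n subrr !mul0r.
Qed.

(** [levin_mx] on the interior rows and columns; the rows [0] and [N] are those of
the identity and enforce that the end coefficients vanish. *)
Definition band_mx (a b : C) (g : {poly C}) : 'M[C]_nu.+2 := \matrix_(k, n)
  (if inner k then (if inner n then levin_mx a b g k n else 0) else (k == n)%:R).

Lemma band_mx_mul a b g x y : zero_ends y ->
  (band_mx a b g *m x = y) <->
  zero_ends x /\ (forall k : 'I_nu.+2, inner k -> (levin_mx a b g *m x) k ord0 = y k ord0).
Proof.
move=> hy.
have ends (k : 'I_nu.+2) : ~~ inner k -> (band_mx a b g *m x) k ord0 = x k ord0.
  move=> nk; rewrite mxE (bigD1 k) //= big1 => [|n nk'].
    by rewrite mxE (negPf nk) eqxx mul1r addr0.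
  by rewrite mxE (negPf nk) eq_sym (negPf nk') mul0r.
have inn (k : 'I_nu.+2) : zero_ends x -> inner k ->
    (band_mx a b g *m x) k ord0 = (levin_mx a b g *m x) k ord0.
  move=> hx kin; rewrite !mulmx_zero_ends //; apply: eq_bigr => n nin.
  by rewrite mxE kin nin.
move/zero_endsP: (hy) => hy'.
split=> [h|[hx h]].
  have hx : zero_ends x by apply/zero_endsP => k nk; rewrite -ends // h hy'.
  by split=> // k kin; rewrite -inn // h.
apply/colP => k; have [kin|nk] := boolP (inner k); first by rewrite inn // h.
by rewrite ends // hy' //; move/zero_endsP: hx; exact.
Qed.

Lemma Pnu_zero_ends (x : 'cV[C]_nu.+2) : zero_ends (Pnu x).
Proof. by split; rewrite mxE /= ?ltnn. Qed.

Lemma Pnu_id (x : 'cV[C]_nu.+2) : zero_ends x -> Pnu x = x.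
Proof.
move=> /zero_endsP hx; apply/colP => k; rewrite mxE; case: ifP => // /negbT nk.
by rewrite hx.
Qed.

Lemma f_tilde_zero_ends (f : R -> R[i]) : zero_ends (f_tilde nu f).
Proof.
have h m : grid_cos m ^+ 2 = 1 -> (1 - cc_point R nu m ^+ 2)%:C = 0.
  by move=> h; rewrite rmorphB rmorphXn /= cc_point_cos h rmorph1 subrr.
split; rewrite mxE h ?mul0r //= ?grid_cos0 ?expr1n //.
by rewrite -[X in grid_cos X]mul1n grid_cosN sqrrN !expr1n.
Qed.

(** The residual [r] of the banded equations has grid values equal to the residual
of the Levin system.  One vanishes at the interior nodes exactly if the other
vanishes at the interior frequencies: grid values at the ends are always zero, so
in either case [r = 0], by invertibility of [values_mx] in one direction and by
[ends_zero] in the other. *)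
Lemma system_banded g omega f x : ~~ odd nu ->
  (zero_ends x /\ levin_system g omega f x) <->
  band_mx 1 ('i * omega%:C) g *m x = Pnu (dct_coords (f_tilde nu f)).
Proof.
move=> nu_even; rewrite band_mx_mul; last exact: Pnu_zero_ends.
set b := 'i * _; set B := levin_mx 1 b g.
pose r := B *m x - dct_coords (f_tilde nu f).
have Vr : zero_ends x -> values_mx *m r = A_tilde nu g omega *m x - f_tilde nu f.
  move=> hx; rewrite mulmxBr dct_coordsK mulmxA; congr (_ - _); apply/colP => m.
  by rewrite !mulmx_zero_ends //; apply: eq_bigr => n nin; rewrite A_tildeE.
have Vr0 : zero_ends x -> zero_ends (values_mx *m r).
  move=> hx; have [h1 h2] := values_levin_ends 1 b g hx; have [h3 h4] := f_tilde_zero_ends f.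
  by split; rewrite mulmxBr dct_coordsK mxE [X in _ + X]mxE ?h1 ?h2 ?h3 ?h4 subrr.
split=> -[hx h]; split=> //.
  have r0 : r = 0.
    have V0 : values_mx *m r = 0.
      apply/colP => m; rewrite [RHS]mxE; have [mi|nm] := boolP (inner m); last first.
        by move/zero_endsP: (Vr0 hx); exact.
      move/colP: h => /(_ m); rewrite (Pnu_id hx) Vr // !mxE -/(inner m) mi => ->.
      by rewrite subrr.
    by rewrite -[r]mul1mx -(mulVmx values_mx_unit) -mulmxA V0 mulmx0.
  move=> k kin; rewrite [RHS]mxE -/(inner k) kin; apply/eqP; rewrite -subr_eq0.
  by move/colP: r0 => /(_ k); rewrite /r mxE [X in _ + X]mxE [RHS]mxE => ->.
have r0 : r = 0.
  apply: (ends_zero nu_even _ (Vr0 hx)) => k kin.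
  by rewrite /r mxE [X in _ + X]mxE (h k kin) [X in X - _]mxE -/(inner k) kin subrr.
by rewrite /levin_system (Pnu_id hx); congr Pnu; apply/eqP; rewrite -subr_eq0 -Vr // r0 mulmx0.
Qed.

End Levin.

(** * Unique solvability for large frequencies *)

Section Nonsingular.
Variable R : realType.
Variable nu : nat.
Local Notation C := R[i].
Local Notation N := nu.+1.

Lemma sin_grid_gt0 m : inner nu m -> 0 < sin (m%:R * pi / N%:R) :> R.
Proof.
move=> /andP[m0 mN]; apply: sin_gt0_pi; apply/andP; split.
  by rewrite divr_gt0 ?mulr_gt0 ?pi_gt0 ?ltr0n.
by rewrite ltr_pdivrMr ?ltr0n // mulrC ltr_pM2l ?pi_gt0 // ltr_nat.
Qed.

Lemma weight_neq0 m : inner nu m -> 1 - grid_cos R nu m ^+ 2 != 0.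
Proof.
move=> /sin_grid_gt0 s0; rewrite /grid_cos -rmorphXn -(rmorph1 (real_complex R)) -rmorphB /=.
rewrite -sin2cos2 (fmorph_eq0 (real_complex R)) expf_neq0 //.
by rewrite gt_eqF.
Qed.

Lemma trap_neq0 k : (trap_weight R N k)%:C != 0.
Proof.
rewrite (fmorph_eq0 (real_complex R)) /trap_weight.
by case: ifP => _; rewrite ?oner_eq0 // invr_eq0 pnatr_eq0.
Qed.

(** [T_1, ..., T_nu] are linearly independent on the interior nodes.  The transform
of [values_mx *m x] is again [x] up to weights, so [ends_zero] applies with the
roles of nodes and frequencies exchanged. *)
Lemma values_inj (x : 'cV[C]_nu.+2) : ~~ odd nu -> zero_ends x ->
  (forall m : 'I_nu.+2, inner nu m -> (values_mx R nu *m x) m ord0 = 0) -> x = 0.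
Proof.
move=> nu_even [x0 xN] hV.
(* x = trap_mx z, so that the inversion formula applies to z *)
pose z : 'cV[C]_nu.+2 := \col_k (x k ord0 / (trap_weight R N k)%:C).
have xz : x = trap_mx R nu *m z.
  by apply/colP => k; rewrite mul_diag_mx !mxE mulrC divfK // trap_neq0.
pose u := trap_mx R nu *m (values_mx R nu *m x).
have Vu : values_mx R nu *m u = (N%:R / 2) *: z.
  by rewrite /u {1}xz !mulmxA values_mx_inv mul_scalar_mx.
have u0 : u = 0.
  apply: (ends_zero nu_even) => [k kin|].
    by rewrite /u mul_diag_mx mxE [_ *m _]lock mxE -lock hV // mulr0.
  by rewrite Vu; split; rewrite !mxE ?x0 ?xN mul0r mulr0.
have : z = 0.
  apply: (scalerI (N2_neq0 R nu)).
  by rewrite scaler0 -Vu u0 mulmx0.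
by move=> z0; rewrite xz z0 mulmx0.
Qed.

Lemma band_mx_ker a b (g : {poly C}) (x : 'cV[C]_nu.+2) :
  (band_mx nu a b g *m x = 0) <->
  zero_ends x /\ (forall k : 'I_nu.+2, inner nu k -> (levin_mx nu a b g *m x) k ord0 = 0).
Proof.
have z0 : zero_ends (0 : 'cV[C]_nu.+2) by split; rewrite mxE.
split=> [/(band_mx_mul _ _ _ _ z0)|] [hx h]; last apply/(band_mx_mul _ _ _ _ z0).
  by split=> // k kin; rewrite h // mxE.
by split=> // k kin; rewrite h // mxE.
Qed.

Lemma band_mx_limit_unit (g : {poly C}) : ~~ odd nu ->
  (forall x : R, -1 <= x <= 1 -> (g^`()).[x%:C] != 0) -> band_mx nu 0 1 g \in unitmx.
Proof.
move=> nu_even hg; apply: inj_unitmx => x /band_mx_ker [hx h].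
have Bx0 : levin_mx nu 0 1 g *m x = 0.
  apply: (ends_zero nu_even _ (values_levin_ends _ _ _ hx)) => k kin.
  exact: h.
apply: values_inj => // m min.
have : (values_mx R nu *m (levin_mx nu 0 1 g *m x)) m ord0 = 0 by rewrite Bx0 mulmx0 mxE.
rewrite mulmxA mulmx_zero_ends // (eq_bigr (fun n : 'I_nu.+2 =>
  ((1 - grid_cos R nu m ^+ 2) * (g^`()).[grid_cos R nu m]) * (values_mx R nu m n * x n ord0))); last first.
  by move=> n nin; rewrite values_mx_levin // mxE; ring.
rewrite -mulr_sumr -mulmx_zero_ends // => /eqP; rewrite mulf_eq0 => /orP[|/eqP //].
rewrite mulf_eq0 (negPf (weight_neq0 min)) /= (negPf (hg _ _)) //.
by rewrite cos_geN1 cos_le1.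
Qed.

(** The roots are finitely many and a nonzero root [z] is of the form
[(i omega)^-1] only for [omega = Im (z^-1)], so the sum of all these absolute
values is a valid threshold. *)
Lemma poly_nonroot_imaginary (q : {poly C}) : q.[0] != 0 ->
  exists omega0 : R, 0 <= omega0 /\
    forall omega, omega0 < omega -> q.[('i * omega%:C)^-1] != 0.
Proof.
move=> q0; have [r qE] := closed_field_poly_normal q.
have qn0 : q != 0 by apply: contraNneq q0 => ->; rewrite horner0.
exists (\sum_(z <- r) `|complex.Im z^-1|); split; first by exact: sumr_ge0.
move=> omega; apply: contraTN => /= qz.
have zr : ('i * omega%:C)^-1 \in r.
  move: qz; rewrite {1}qE hornerZ mulf_eq0 lead_coef_eq0 (negPf qn0) /=.
  by rewrite -rootE root_prod_XsubC.
rewrite -leNgt (big_rem _ zr) invrK.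
have -> : complex.Im ('i * omega%:C) = omega by rewrite /= mul0r mul1r add0r.
by rewrite ler_wpDr ?ler_norm // sumr_ge0.
Qed.

(** [band_mx t 1 g] depends affinely on [t], so its determinant is a polynomial in
[t], nonzero at [t = 0].  For [t = (i omega)^-1] it has the same kernel as the
matrix of the system, whose interior rows are [i omega] times its own. *)
Lemma band_mx_large_unit (g : {poly C}) : ~~ odd nu ->
  (forall x : R, -1 <= x <= 1 -> (g^`()).[x%:C] != 0) ->
  exists omega0 : R, forall omega, omega0 < omega ->
    band_mx nu 1 ('i * omega%:C) g \in unitmx.
Proof.
move=> nu_even /(band_mx_limit_unit nu_even) U0.
pose E : 'M[C]_nu.+2 := \matrix_(k, n) (if inner nu k && inner nu n then deriv_mx R nu k n else 0).
have ME t : band_mx nu t 1 g = band_mx nu 0 1 g + t *: E.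
  apply/matrixP => k n; rewrite !mxE; case: (inner nu k); case: (inner nu n) => /=; rewrite ?mxE; ring.
pose q : {poly C} := \det (map_mx polyC (band_mx nu 0 1 g) + 'X *: map_mx polyC E).
have qE t : q.[t] = \det (band_mx nu t 1 g).
  rewrite -[_.[t]]/(horner_eval t q) -det_map_mx; congr (\det _).
  apply/matrixP => k n; rewrite (ME t); move: (band_mx nu 0 1 g) (E) => M0 E0.
  by rewrite !mxE /= /horner_eval hornerD hornerM hornerX !hornerC.
have [omega0 [w0 hw]] : exists omega0 : R, 0 <= omega0 /\
    forall omega, omega0 < omega -> q.[('i * omega%:C)^-1] != 0.
  by apply: poly_nonroot_imaginary; rewrite qE -unitfE -unitmxE.
exists omega0 => omega hom; apply: inj_unitmx => x.
move=> /band_mx_ker [hx h].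
set b := 'i * omega%:C in h hw *.
have b0 : b != 0.
  apply/eqP => /(congr1 (@complex.Im R)); rewrite /b /= mul0r mul1r add0r => om0.
  by move: hom; rewrite om0 ltNge w0.
have U : band_mx nu b^-1 1 g \in unitmx by rewrite unitmxE unitfE -qE hw.
rewrite -[x]mul1mx -(mulVmx U) -mulmxA.
have -> : band_mx nu b^-1 1 g *m x = 0.
  apply/band_mx_ker; split; first exact: hx.
  move=> k kin.
  have -> : levin_mx nu b^-1 1 g = b^-1 *: levin_mx nu 1 b g.
    by rewrite /levin_mx scalerDr !scalerA mulr1 mulVf.
  by rewrite -scalemxAl mxE h // mulr0.
by rewrite mulmx0.
Qed.

Lemma levin_mx_bandwidth a b (g : {poly C}) :
  (0 < size g)%N -> bandwidth (size g) (levin_mx nu a b g).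
Proof.
move=> g0; apply: bandwidth_add; apply: bandwidth_scale.
  apply: (@bandwidth_leq _ _ 1 (size g)) => // i j ij; rewrite mxE.
  have -> : (i.+1 == j) = false by lia.
  have -> : (i == j.+1 :> nat) = false by lia.
  by rewrite subr0 mulr0.
have X1 : bandwidth 1 (mulX_mx R nu).
  move=> i j ij; rewrite mxE.
  have -> : (i.+1 == j) = false by lia.
  have -> : (i == j.+1 :> nat) = false by lia.
  by rewrite addr0 mulr0.
have hb := bandwidth_horner (p := (1 - 'X^2) * g^`()) X1.
apply: (bandwidth_leq _ hb).
have h1 := size_polyMleq (1 - 'X^2) g^`().
have h2 : (size (1 - 'X^2 : {poly C})%R <= 3)%N.
  by apply: leq_trans (size_polyD _ _) _; rewrite size_polyN size_polyXn size_poly1.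
have h3 : (size g^`() <= (size g).-1)%N by exact: size_poly.
move: h1 h2 h3 g0; move: (size ((1 - 'X^2) * g^`())%R) (size (1 - 'X^2)%R).
move: (size g^`()) (size g) => x y z t; lia.
Qed.

Lemma band_mx_bandwidth a b (g : {poly C}) d : size g = d.+1 -> bandwidth d.+1 (band_mx nu a b g).
Proof.
move=> sg k n kn; rewrite mxE; case: ifP => _; last first.
  by case: eqP kn => // ->; lia.
by case: ifP => // _; rewrite (@levin_mx_bandwidth a b g) // sg; lia.
Qed.

End Nonsingular.

(** * Programs for the transform and for the assembly of the matrix *)

Section Assembly.
Variable R : realType.
Local Notation C := R[i].

Lemma vec_prog n (Phi : (nat -> C) -> nat -> C) c : (0 < n)%N ->
  (forall x y, (forall i, (i < n)%N -> x i = y i) ->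
     forall j, (j < n)%N -> Phi x j = Phi y j) ->
  slp n Phi c ->
  exists (p : prog C) (t : nat), (t <= c)%N /\
    forall x : 'cV[C]_n, run p (vec_entries x) = Some (mkseq (Phi (vec_fun x)) n, t).
Proof.
move=> n0 dep sP; have [p [t [tc hp]]] := slp_prog n0 dep sP.
exists p, t; split=> // x; rewrite hp vec_entriesE ?size_mkseq //.
congr (Some (_, _)); apply/eq_in_map => j; rewrite mem_iota add0n => /andP[_ jn].
by apply: dep => // i lin; rewrite nth_mkseq.
Qed.

Lemma diag_prog n (a : nat -> C) : (0 < n)%N ->
  exists (p : prog C) (t : nat), (t <= n)%N /\
    forall x : 'cV[C]_n,
      run p (vec_entries x) = Some (vec_entries (\col_(k < n) (a k * x k ord0)), t).
Proof.
move=> n0; have sD : slp n (fun (x : nat -> C) k => a k * x k) (n * 1).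
  by apply: slp_map => j _; exact: slp_scale (slp_var _ (fun=> j) 1).
rewrite muln1 in sD.
have [|p [t [tc hp]]] := vec_prog n0 _ sD; first by move=> x y xy j jn; rewrite xy.
exists p, t; split=> // x; rewrite hp vec_entriesE; congr (Some (_, _)).
apply/eq_in_map => j; rewrite mem_iota add0n => /andP[_ jn].
by rewrite -[j]/(val (Ordinal jn)) !vec_funE mxE.
Qed.

Lemma dct_prog nu : exists (p : prog C) (t : nat),
  (t <= 2 * ((8 * trunc_log 2 (2 * nu.+1) + 9) * (2 * (2 * nu.+1))) + 8 * nu.+2)%N /\
  forall x : 'cV[C]_nu.+2, run p (vec_entries x) = Some (vec_entries (dct1 x), t).
Proof.
have := @trunc_log_bounds 2 (2 * nu.+1) isT isT; set r := trunc_log _ _ => /= /andP[r1 r2].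
have [||p [t [tc hp]]] := vec_prog _ _ (slp_dct R r2); first by [].
  by move=> x y xy j jn; apply: eq_bigr => k _; rewrite xy.
exists p, t; split.
  have r3 : (2 ^ r.+1 <= 2 * (2 * nu.+1))%N by rewrite expnS leq_mul2l.
  by apply: leq_trans tc _; rewrite leq_add2r !leq_mul2l r3 !orbT.
move=> x; rewrite hp vec_entriesE; congr (Some (_, _)).
apply/eq_in_map => j; rewrite mem_iota add0n => /andP[_ jn].
rewrite -[j]/(val (Ordinal jn)) !vec_funE dct1E.
by apply: eq_bigr => k _; rewrite vec_funE.
Qed.

Variables nu d : nat.

Definition inband (k l : nat) :=
  [&& inner nu k, inner nu l, (k <= l + d.+1)%N & (l <= k + d.+1)%N].

(** The coefficient matrix of [omega * g_(j+1)] in the banded matrix. *)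
Definition entry_coef (j : nat) : 'M[C]_nu.+2 :=
  ('i * j.+1%:R) *: horner_mx (mulX_mx R nu) ((1 - 'X^2) * 'X^j).

(** The input lists [omega, g_0, ..., g_d], so [x j.+2] is [g_(j+1)], the
coefficient that produces the term [x^j] of [g'].  Outside the band the entries
are constants and cost nothing. *)
Definition entry (k l : nat) (x : nat -> C) : C :=
  if inband k l then
    mx_fun (deriv_mx R nu) k l + \sum_(j < d) (mx_fun (entry_coef j) k l * x 0%N) * x j.+2
  else if inner nu k then 0 else (k == l)%:R.

Lemma slp_entry k l :
  slp 1 (fun (x : nat -> C) _ => entry k l x) (if inband k l then (3 * d).+1 else 0%N).
Proof.
rewrite /entry; case: (inband k l); last exact: slp_const.
have sS : slp 1 (fun (x : nat -> C) (_ : nat) =>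
    \sum_(j < d) (mx_fun (entry_coef j) k l * x 0%N) * x j.+2) (d * 3).
  apply: (slp_sum (Phi := fun j (x : nat -> C) _ => (mx_fun (entry_coef j) k l * x 0%N) * x j.+2)) => j _.
  exact: slp_mul (slp_scale _ (slp_var _ (fun=> 0%N) 1)) (slp_var _ (fun=> j.+2) 1).
apply: (@slp_weaken _ _ _ _ (0 + d * 3).+1); first by lia.
exact: (slp_add (@slp_const _ nat (mx_fun (deriv_mx R nu) k l : C)) sS).
Qed.

Lemma deriv_expansion (g : {poly C}) : size g = d.+1 ->
  g^`() = \sum_(j < d) (j.+1%:R * g`_j.+1) *: 'X^j.
Proof.
move=> sg; rewrite /deriv sg poly_def; apply: eq_bigr => j _.
by rewrite mulr_natl.
Qed.

Lemma entryE (g : {poly C}) (omega : R) : size g = d.+1 ->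
  band_mx nu 1 ('i * omega%:C) g =
  \matrix_(k < nu.+2, l < nu.+2) entry k l (nth 0 (omega%:C :: polyseq g)).
Proof.
move=> sg; apply/matrixP => k l; rewrite [RHS]mxE /entry.
have [band|nband] := boolP ((k <= l + d.+1)%N && (l <= k + d.+1)%N); last first.
  have -> : inband k l = false by rewrite /inband (negPf nband) !andbF.
  rewrite (band_mx_bandwidth _ _ sg); last by lia.
  case: ifP => // nk; case: eqP => // kl; case/negP: nband; rewrite kl; lia.
rewrite /inband band andbT [LHS]mxE.
case: (inner nu k) => //=; case: (inner nu l) => //.
rewrite !mx_funE mxE [X in X + _]mxE [X in _ + X]mxE mul1r; congr (_ + _).
rewrite (deriv_expansion sg) mulr_sumr raddf_sum summxE mulr_sumr.
apply: eq_bigr => j _; rewrite mx_funE /entry_coef mxE -scalerAr /= horner_mxZ mxE; ring.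
Qed.

Lemma sum_mkseq2 (f : nat -> nat -> nat) m n : (0 < n)%N ->
  (\sum_(k < m * n) f (k %/ n) (k %% n) = \sum_(i < m) \sum_(j < n) f i j)%N.
Proof.
move=> n0; have := congr1 sumn (flatten_mkseq f m n0).
rewrite sumn_flatten -map_comp !sumnE !big_map => h.
rewrite -(big_mkord predT (fun k => f (k %/ n)%N (k %% n)%N)) /index_iota subn0 -h.
rewrite -(big_mkord predT (fun i => \sum_(j < n) f i j)%N) /index_iota subn0.
apply: eq_bigr => i _ /=; rewrite sumnE big_map.
by rewrite -(big_mkord predT (f i)) /index_iota subn0.
Qed.

Lemma inband_count n k c :
  (\sum_(l < n) (if inband k l then c else 0) <= (2 * d + 3) * c)%N.
Proof.
rewrite -big_mkcond sum_nat_cond_const leq_mul2r; apply/orP; right.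
(* the position of column l inside the window of row k *)
pose f (l : 'I_n) : 'I_(2 * d + 2).+1 := inord (l + d.+1 - k).
rewrite addn3 -addn2 -[X in (_ <= X)%N]card_ord.
rewrite -(card_in_imset (f := f)) ?max_card //.
move=> l l'; rewrite !inE => /and4P[_ _ h1 h2] /and4P[_ _ h3 h4].
move=> /(congr1 val); rewrite /f /= !inordK; [|lia|lia] => h.
by apply: val_inj => /=; lia.
Qed.

Lemma assemble_prog : exists (p : prog C) (t : nat),
  (t <= nu.+2 * ((2 * d + 3) * (3 * d).+1))%N /\
  forall (g : {poly C}) (omega : R), size g = d.+1 ->
    run p (omega%:C :: polyseq g) = Some (mx_entries (band_mx nu 1 ('i * omega%:C) g), t).
Proof.
pose n := nu.+2; pose Phi (x : nat -> C) k := entry (k %/ n)%N (k %% n)%N x.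
have sP := slp_par (fun k (_ : (k < n * n)%N) => slp_entry (k %/ n)%N (k %% n)%N).
have [||p [t [tc hp]]] := slp_prog (n := d.+2) (Phi := Phi) _ _ sP; first by [].
  move=> x y xy j _; rewrite /Phi /entry xy //; case: ifP => // _; congr (_ + _).
  by apply: eq_bigr => k _; rewrite xy // !ltnS.
exists p, t; split.
  apply: leq_trans tc _.
  rewrite (sum_mkseq2 (fun k l => if inband k l then (3 * d).+1 else 0%N)) //.
  have <- : (\sum_(i < n) (2 * d + 3) * (3 * d).+1 = n * ((2 * d + 3) * (3 * d).+1))%N.
    by rewrite sum_nat_const card_ord.
  by apply: leq_sum => i _; exact: inband_count.
move=> g omega sg; rewrite hp /= ?sg // (entryE _ sg).
by rewrite (mx_entries_fun (fun k l => entry k l (nth 0 (omega%:C :: polyseq g)))).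
Qed.

End Assembly.

(** * The solver and its operation count *)

Section Final.
Variable R : realType.
Local Notation C := R[i].

(** A constant [g] has [g' = 0], so the bound may absorb [nu] into [d^2 nu]. *)
Lemma deriv_nonzero_size (g : {poly C}) d : size g = d.+1 ->
  (forall x : R, -1 <= x <= 1 -> (g^`()).[x%:C] != 0) -> (0 < d)%N.
Proof.
move=> sg /(_ 0); rewrite lerN10 ler01 => /(_ isT); apply: contraNT.
rewrite -eqn0Ngt => /eqP d0.
have /size1_polyC -> : (size g <= 1)%N by rewrite sg d0.
by rewrite derivC horner0.
Qed.

(** The terms are: scaling before and after the transform, the DCT, the assembly
of the matrix, and the elimination. *)
Definition op_count (d nu : nat) : nat :=
  (2 * nu.+2 +
   (2 * ((8 * trunc_log 2 (2 * nu.+1) + 9) * (2 * (2 * nu.+1))) + 8 * nu.+2) +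
   nu.+2 * ((2 * d + 3) * (3 * d).+1) + 4 * nu.+2 * (2 * d.+1 + 2) ^ 2)%N.

Lemma solver_exists (d nu : nat) : exists S : dct_band_solver R,
  [/\ computes_dct1 nu (transform S),
      solves_banded nu.+2 (2 * d + 3) (band_solve S) &
      ~~ odd nu -> forall (g : {poly C}) (omega : R) (f : R -> C),
        size g = d.+1 ->
        (exists alpha0 : 'cV[C]_nu.+2,
           zero_ends alpha0 /\ levin_system g omega f alpha0) ->
        exists (alpha : 'cV[C]_nu.+2) (ops : nat),
          [/\ solver_run (2 * d + 3) S g omega f alpha ops,
              zero_ends alpha, levin_system g omega f alpha &
              (ops <= op_count d nu)%N]].
Proof.
pose n := nu.+2.
have [p1 [t1 [c1 h1]]] := diag_prog (n := n) (fun m => (1 - cc_point R nu m ^+ 2)%:C) isT.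
have [p2 [t2 [c2 h2]]] := dct_prog R nu.
have [p3 [t3 [c3 h3]]] := diag_prog (n := n)
  (fun k => if inner nu k then (nu.+1%:R / 2)^-1 * (trap_weight R nu.+1 k)%:C else 0 : C) isT.
have [p4 [t4 [c4 h4]]] := assemble_prog R nu d.
have [p5 h5] := @band_solver C n d.+1 isT.
exists (DctBandSolver p1 p2 p3 p4 p5); split=> /=.
- by move=> x; exists t2.
- move=> M y [b wb hM] hx; have [|x [t [r1 r2 _]]] := h5 M y _ hx.
    have -> : d.+1 = b by lia.
    exact: hM.
  by exists x, t.
move=> nu_even g omega f sg hsol.
pose M := band_mx nu 1 ('i * omega%:C) g.
pose y := Pnu (dct_coords (f_tilde nu f)).
have [|alpha [t5 [r1 r2 r3]]] := h5 M y (band_mx_bandwidth _ _ sg).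
  by have [alpha0 /(system_banded _ _ _ _ nu_even) ha] := hsol; exists alpha0.
have [za la] : zero_ends alpha /\ levin_system g omega f alpha.
  exact/system_banded.
exists alpha, (t1 + t2 + t3 + t4 + t5)%N; split=> //; last first.
  by rewrite /op_count; move: c1 c2 c3 c4 r3; rewrite /n; lia.
exists (f_tilde nu f), y, M, t1, t2, t3, t4, t5; split=> /=.
- rewrite h1; congr (Some (vec_entries _, _)).
  by apply/colP => m; rewrite !mxE.
- by rewrite h2.
- rewrite h3; congr (Some (vec_entries _, _)).
  apply/colP => k; rewrite [LHS]mxE [RHS]mxE -/(inner nu k).
  case: (inner nu k); last by rewrite mul0r.
  by rewrite /dct_coords [RHS]mxE mul_diag_mx [X in _ = _ * X]mxE
    [X in _ = _ * (X * _)]mxE mulrA.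
- by rewrite h4.
split=> //; exists d.+1; first by lia.
exact: band_mx_bandwidth.
Qed.

Lemma op_count_nat d nu : (0 < d)%N -> (1 < nu)%N ->
  (op_count d nu <= 128 * trunc_log 2 (2 * nu.+1) * nu + 492 * d ^ 2 * nu)%N.
Proof.
move=> d0 nu1; rewrite /op_count; move: (trunc_log _ _) => r.
have e1 : (nu.+2 <= 2 * nu)%N by lia.
have e2 : (nu.+1 <= 2 * nu)%N by lia.
have e3 : ((2 * d + 3) * (3 * d).+1 <= 20 * d ^ 2)%N by nia.
have e4 : ((2 * d.+1 + 2) ^ 2 <= 36 * d ^ 2)%N by nia.
have e5 : (nu.+2 * ((2 * d + 3) * (3 * d).+1) <= 2 * nu * (20 * d ^ 2))%N by exact: leq_mul.
have e6 : (4 * nu.+2 * (2 * d.+1 + 2) ^ 2 <= 4 * (2 * nu) * (36 * d ^ 2))%N.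
  by apply: leq_mul => //; rewrite leq_mul2l.
have e7 : ((8 * r + 9) * (2 * (2 * nu.+1)) <= (8 * r + 9) * (2 * (2 * (2 * nu))))%N.
  by rewrite !leq_mul2l e2 !orbT.
have e8 : (nu <= d ^ 2 * nu)%N by rewrite leq_pmull // expn_gt0 d0.
nia.
Qed.

(** With [r] the logarithm on the left, [2^r <= 2 (nu + 1) <= nu^3] for [nu >= 2]. *)
Lemma trunc_log_ln nu : (1 < nu)%N ->
  (trunc_log 2 (2 * nu.+1))%:R * ln 2 <= 3 * ln nu%:R :> R.
Proof.
move=> nu1; have /andP[h _] := @trunc_log_bounds 2 (2 * nu.+1) isT isT.
rewrite mulr_natl mulr_natl -!lnXn ?ltr0n //; last exact: ltnW.
rewrite ler_ln ?posrE ?exprn_gt0 ?ltr0n //; last exact: ltnW.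
rewrite -!natrX ler_nat; apply: leq_trans h _; nia.
Qed.

Lemma op_count_bound d nu : (0 < d)%N -> (1 < nu)%N ->
  (op_count d nu)%:R <= (492 + 384 / ln 2) *
     (nu%:R * ln nu%:R + d%:R ^+ 2 * nu%:R) :> R.
Proof.
move=> d0 nu1.
apply: le_trans (_ : (128 * trunc_log 2 (2 * nu.+1) * nu + 492 * d ^ 2 * nu)%:R <= _).
  by rewrite ler_nat op_count_nat.
have l2 : 0 < ln 2 :> R by apply: ln_gt0; rewrite ltr1n.
have ln0 : 0 <= ln nu%:R :> R by rewrite ln_ge0 // ler1n ltnW.
have h := trunc_log_ln nu1.
rewrite natrD !natrM -expr2; move: (trunc_log _ _)%:R h => r h.
have hr : r <= 3 / ln 2 * ln nu%:R.
  by rewrite mulrAC ler_pdivlMr.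
have n0 : 0 <= nu%:R :> R by [].
have dn0 : 0 <= d%:R ^+ 2 * nu%:R :> R by rewrite mulr_ge0 // sqr_ge0.
have i0 : 0 <= (ln 2)^-1 :> R by rewrite invr_ge0 ltW.
have hrn : r * nu%:R <= 3 / ln 2 * ln nu%:R * nu%:R by rewrite ler_wpM2r.
have p1 : 0 <= nu%:R * ln nu%:R :> R by rewrite mulr_ge0.
have p2 : 0 <= (ln 2)^-1 * (d%:R ^+ 2 * nu%:R) :> R by rewrite mulr_ge0.
move: hrn p1 p2 dn0; set a := (ln 2)^-1; set b := ln nu%:R; set v := nu%:R; set e := d%:R ^+ 2.
nra.
Qed.

End Final.

Theorem proposition1 (R : realType) :
  (forall (d nu : nat) (g : {poly R[i]}),
     size g = d.+1 ->
     (forall x : R, -1 <= x <= 1 -> (g^`()).[x%:C] != 0) ->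
     (0 < nu)%N -> ~~ odd nu -> (d.+1 <= nu)%N ->
     exists omega0 : R, forall omega : R, omega0 < omega ->
       forall f : R -> R[i],
         exists! alpha : 'cV[R[i]]_nu.+2,
           zero_ends alpha /\ levin_system g omega f alpha)
  /\
  (exists (K : R) (S : nat -> nat -> dct_band_solver R),
     forall d nu : nat, (0 < nu)%N -> ~~ odd nu -> (d.+1 <= nu)%N ->
       [/\ computes_dct1 nu (transform (S d nu)),
           solves_banded nu.+2 (2 * d + 3) (band_solve (S d nu)) &
           forall (g : {poly R[i]}) (omega : R) (f : R -> R[i]),
             size g = d.+1 ->
             (forall x : R, -1 <= x <= 1 -> (g^`()).[x%:C] != 0) ->
             (exists alpha0 : 'cV[R[i]]_nu.+2,
                zero_ends alpha0 /\ levin_system g omega f alpha0) ->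
             exists (alpha : 'cV[R[i]]_nu.+2) (ops : nat),
               [/\ solver_run (2 * d + 3) (S d nu) g omega f alpha ops,
                   zero_ends alpha,
                   levin_system g omega f alpha &
                   ops%:R <= K * (nu%:R * ln nu%:R + d%:R ^+ 2 * nu%:R)]]).
Proof.
split=> [d nu g sg hg nu0 nu_even dnu|].
  have [omega0 hw] := band_mx_large_unit nu_even hg.
  exists omega0 => omega /hw U f; set M := band_mx _ _ _ _ in U.
  exists (invmx M *m Pnu (dct_coords (f_tilde nu f))); split.
    by apply/system_banded => //; rewrite mulKVmx.
  move=> alpha /(system_banded _ _ _ _ nu_even) <-.
  by rewrite -/M mulKmx.
have [S hS] := choice (fun p : nat * nat => solver_exists R p.1 p.2).
exists (492 + 384 / ln 2), (fun d nu => S (d, nu)) => d nu nu0 nu_even dnu.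
have [h1 h2 h3] := hS (d, nu); split=> // g omega f sg hg hsol.
have [alpha [ops [r1 r2 r3 r4]]] := h3 nu_even g omega f sg hsol.
exists alpha, ops; split=> //.
have d0 : (0 < d)%N := deriv_nonzero_size sg hg.
have nu1 : (1 < nu)%N by lia.
by apply: le_trans (op_count_bound R d0 nu1); rewrite ler_nat.
Qed.
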